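(* Let $A$ be a commutative ring which has the line bundle property. Then the sequence of abelian groups $$0\longrightarrow \operatorname{Pic}(A)\xrightarrow{\ f\ } K_0(A)^{\ast}\xrightarrow{\ g\ }\mathcal{B}(A)\longrightarrow 0$$ is split exact, where $f(L)=[L,0]$ and $g([M,N])$ is the unique idempotent $e\in A$ with $(\mathrm{r}_M-\mathrm{r}_N)^{-1}(\{1\})=V(e)$.
   Context: All rings are commutative with identity; $R^{\ast}$ is the group of units of a ring $R$. A ring $A$ has the line bundle property if for every integer $d\geqslant 0$ and every finitely generated projective $A$-module $M$ of constant rank $d+1$, there is some $n\geqslant 0$ with $A^{n}\oplus M\simeq A^{n+d}\oplus\Lambda^{d+1}(M)$ as $A$-modules, where $\Lambda^{d+1}$ is the exterior power. $\operatorname{Pic}(A)$ is the Picard group: isomorphism classes of finitely generated projective $A$-modules of constant rank $1$ under $\otimes_A$. $K_0(A)$ is the Grothendieck ring of the semiring of isomorphism classes of finitely generated projective $A$-modules (addition $\oplus$, multiplication $\otimes_A$); its elements are written $[M,N]$ (the formal difference of the class of $M$ and the class of $N$). For a finitely generated projective $A$-module $M$, $\mathrm{r}_M:\operatorname{Spec}(A)\to\mathbb{Z}$ is its rank map, $\mathfrak p\mapsto \operatorname{rank}_{A_{\mathfrak p}}(M_{\mathfrak p})$. $V(e)=\{\mathfrak p\in \operatorname{Spec}(A): e\in\mathfrak p\}$. $\mathcal{B}(A)=\{e\in A: e=e^2\}$ is the abelian group of idempotents of $A$ under the operation $e\oplus e':=e+e'-2ee'$. The maps $f$ and $g$ are well-defined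 group homomorphisms for every commutative ring $A$. *)

(* Defs.v *)
From HB Require Import structures.
From mathcomp Require Import all_boot all_order all_algebra ring.
From mathcomp Require Import boolp classical_sets.

Set Implicit Arguments.
Unset Strict Implicit.
Unset Printing Implicit Defensive.

Import GRing.Theory.
Local Open Scope ring_scope.
Local Open Scope quotient_scope.

(* All rings are possibly trivial (the mathcomp prefix "pz"); [A^n] is
   ['rV[A]_n] and the direct sum of [M] and [N] is [(M * N)%type]. *)

Definition lin_iso (R : pzRingType) (M N : lmodType R) : Prop :=
  exists f : {linear M -> N}, bijective f.

Section LinIso.
Variable R : pzRingType.
Implicit Types M N P : lmodType R.

Lemma linear_pack M N (f : M -> N) :
  linear f -> {g : {linear M -> N} | forall x, g x = f x}.
Proof.
move=> lf; pose m := GRing.isLinear.Build R M N *:%R f lf.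
pose g : {linear M -> N} := HB.pack f m.
by exists g.
Qed.

Definition mklin M N (f : M -> N) (lf : linear f) : {linear M -> N} :=
  sval (linear_pack lf).

Lemma mklinE M N (f : M -> N) (lf : linear f) x : mklin lf x = f x.
Proof. exact: svalP (linear_pack lf) x. Qed.

Lemma lin_isoP M N : lin_iso M N <->
  exists f : M -> N, exists g : N -> M, [/\ linear f, cancel f g & cancel g f].
Proof.
split=> [[f [g fK gK]]|[f [g [lf fK gK]]]].
  by exists f, g; split=> //; apply: linearP.
by exists (mklin lf), g => x; rewrite mklinE.
Qed.

Lemma lin_iso_refl M : lin_iso M M.
Proof. by apply/lin_isoP; exists id, id. Qed.

Lemma cancel_linear M N (f : M -> N) (g : N -> M) :
  linear f -> cancel f g -> cancel g f -> linear g.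
Proof. by move=> lf fK gK a x y; apply: (can_inj fK); rewrite lf !gK. Qed.

Lemma lin_iso_sym M N : lin_iso M N -> lin_iso N M.
Proof.
case/lin_isoP=> f [g [lf fK gK]]; apply/lin_isoP; exists g, f; split=> //.
exact: cancel_linear lf fK gK.
Qed.

Lemma lin_iso_trans M N P : lin_iso M N -> lin_iso N P -> lin_iso M P.
Proof.
move=> [f [f' fK f'K]] [g [g' gK g'K]]; exists (g \o f).
by exists (f' \o g') => x /=; rewrite ?gK ?fK ?f'K ?g'K.
Qed.

Lemma prod_iso M M' N N' :
  lin_iso M M' -> lin_iso N N' -> lin_iso (M * N)%type (M' * N')%type.
Proof.
move=> /lin_isoP[f [f' [lf fK f'K]]] /lin_isoP[g [g' [lg gK g'K]]].
apply/lin_isoP; exists (fun z => (f z.1, g z.2)), (fun z => (f' z.1, g' z.2)).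
split=> [a [x1 x2] [y1 y2]|[x y]|[x y]] /=; last 2 first.
- by rewrite fK gK.
- by rewrite f'K g'K.
by rewrite lf lg.
Qed.

Lemma prod_isoC M N : lin_iso (M * N)%type (N * M)%type.
Proof.
apply/lin_isoP; exists (fun z => (z.2, z.1)), (fun z => (z.2, z.1)).
by split=> [a [x1 x2] [y1 y2]|[x y]|[x y]].
Qed.

Lemma prod_isoA M N P : lin_iso (M * (N * P))%type ((M * N) * P)%type.
Proof.
apply/lin_isoP; exists (fun z => ((z.1, z.2.1), z.2.2)).
exists (fun z => (z.1.1, (z.1.2, z.2))).
by split=> [a [x1 [x2 x3]] [y1 [y2 y3]]|[x [y z]]|[[x y] z]].
Qed.

Lemma prod_iso0 M : lin_iso ('rV[R]_0 * M)%type M.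
Proof.
apply/lin_isoP; exists snd, (fun x => (0, x)); split=> // -[x y] /=.
by congr pair; apply/rowP; case.
Qed.

End LinIso.

Section FGProjective.
Variable A : comPzRingType.
Implicit Types M N P : lmodType A.

Definition finitely_generated M : Prop :=
  exists (n : nat) (v : 'I_n -> M),
    forall m, exists c : 'I_n -> A, m = \sum_i c i *: v i.

Definition projective M : Prop :=
  forall (N P : lmodType A) (p : {linear N -> P}) (f : {linear M -> P}),
    (forall y, exists x, p x = y) ->
    exists h : {linear M -> N}, forall m, p (h m) = f m.

Definition fgp M : Prop := finitely_generated M /\ projective M.

Definition dual_basis M : Prop :=
  exists (I : finType) (v : I -> M) (f : I -> {linear M -> A^o}),
    forall m, m = \sum_i (f i m : A) *: v i.

Lemma row_lift n M (v : 'I_n -> M) :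
  {h : {linear 'rV[A]_n -> M} | forall c, h c = \sum_i c 0 i *: v i}.
Proof.
have lh : linear (fun c : 'rV[A]_n => \sum_i c 0 i *: v i).
  move=> a x y; rewrite scaler_sumr -big_split; apply: eq_bigr => i _.
  by rewrite !mxE scalerDl scalerA.
by exists (mklin lh) => c; rewrite mklinE.
Qed.

Lemma fgp_dual_basis M : fgp M <-> dual_basis M.
Proof.
split=> [[[n [v vP]] pM]|[I [v [f fP]]]].
  have [h hP] := row_lift v.
  have hs y : exists x, h x = y.
    have [c ->] := vP y; exists (\row_i c i); rewrite hP.
    by apply: eq_bigr => i _; rewrite mxE.
  have lid : linear (@id M) by [].
  have [s sP] := pM _ _ h (mklin lid) hs.
  have lc i : linear (fun m => s m 0 i : A^o).
    by move=> a x y; rewrite linearP !mxE.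
  by exists 'I_n, v, (fun i => mklin (lc i)) => m; rewrite -[LHS](mklinE lid) -sP hP;
    apply: eq_bigr => i _; rewrite mklinE.
split.
  exists #|I|, (fun i => v (enum_val i)) => m.
  exists (fun i => f (enum_val i) m).
  rewrite [LHS]fP (reindex (@enum_val I predT)) //=.
  exact: onW_bij (enum_val_bij I).
move=> N P p g ps.
have /choice[w wP] : forall i, exists x, p x = g (v i) by move=> i; apply: ps.
have lh : linear (fun m => \sum_i (f i m : A) *: w i).
  move=> a x y; rewrite scaler_sumr -big_split; apply: eq_bigr => i _.
  by rewrite linearP scalerDl scalerA.
exists (mklin lh) => m.
rewrite mklinE [in RHS](fP m) !linear_sum; apply: eq_bigr => i _.
by rewrite !linearZ /= wP.
Qed.

Lemma fgp_row n : fgp 'rV[A]_n.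
Proof.
apply/fgp_dual_basis.
have lc i : linear (fun m : 'rV[A]_n => m 0 i : A^o) by move=> a x y; rewrite !mxE.
exists 'I_n, (fun i => delta_mx 0 i), (fun i => mklin (lc i)) => m.
by rewrite [LHS]row_sum_delta; apply: eq_bigr => i _; rewrite mklinE.
Qed.

Lemma fgp_regular : fgp A^o.
Proof.
apply/fgp_dual_basis.
have li : linear (@id A^o) by [].
exists unit, (fun=> 1 : A^o), (fun=> mklin li) => m.
rewrite big_const card_unit /= addr0 mklinE.
by rewrite /GRing.scale /= mulr1.
Qed.

Lemma fgp_prod M N : fgp M -> fgp N -> fgp (M * N)%type.
Proof.
move=> /fgp_dual_basis[I [v [f fP]]] /fgp_dual_basis[J [w [g gP]]].
apply/fgp_dual_basis.
have l1 i : linear (fun z : M * N => f i z.1) by move=> a x y; rewrite linearP.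
have l2 j : linear (fun z : M * N => g j z.2) by move=> a x y; rewrite linearP.
exists (I + J)%type.
exists (fun k => match k with inl i => (v i, 0) | inr j => (0, w j) end).
exists (fun k => match k with inl i => mklin (l1 i)
                            | inr j => mklin (l2 j) end).
move=> [m n]; rewrite big_sumType /=.
have -> : \sum_i (mklin (l1 i) (m, n) : A) *: (v i, 0 : N) = (m, 0).
  rewrite [in RHS](fP m).
  elim/big_ind2: _ => // [x1 x2 y1 y2 -> ->|i _].
    by rewrite /GRing.add /= /add_pair /= addr0.
  rewrite mklinE /=.
  by rewrite /GRing.scale /= /scale_pair /= scaler0.
have -> : \sum_j (mklin (l2 j) (m, n) : A) *: (0 : M, w j) = (0, n).
  rewrite [in RHS](gP n).
  elim/big_ind2: _ => // [x1 x2 y1 y2 -> ->|i _].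
    by rewrite /GRing.add /= /add_pair /= addr0.
  rewrite mklinE /=.
  by rewrite /GRing.scale /= /scale_pair /= scaler0.
by rewrite /GRing.add /= /add_pair /= addr0 add0r.
Qed.

End FGProjective.

Section Universal.
Variables (A : comPzRingType) (X : choiceType).
Variable C : forall P : lmodType A, (X -> P) -> Prop.
Implicit Types s t : seq (A * X).

Definition ev (P : lmodType A) (phi : X -> P) s : P :=
  \sum_(z <- s) z.1 *: phi z.2.

Lemma ev_cat (P : lmodType A) (phi : X -> P) s t :
  ev phi (s ++ t) = ev phi s + ev phi t.
Proof. exact: big_cat. Qed.

Definition fscale (a : A) s := [seq (a * z.1, z.2) | z <- s].

Lemma ev_scale (P : lmodType A) (phi : X -> P) a s :
  ev phi (fscale a s) = a *: ev phi s.
Proof.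
rewrite /ev /fscale big_map scaler_sumr; apply: eq_bigr => z _.
by rewrite scalerA.
Qed.

(* A formal combination [s] stands for \sum (z.1 *: z.2); two of them are
   identified when every map [phi] in the class [C], into every module, takes
   the same value on both. The quotient represents the functor [C]: it is the
   free module on [X] modulo the submodule generated by the relations satisfied
   by all the maps in [C]; see [ugen], [ulift], [uliftE] and [univ_ext]. *)
Definition feq s t : bool :=
  `[< forall (P : lmodType A) (phi : X -> P), C phi -> ev phi s = ev phi t >].

Lemma feq_equiv : equiv_class_of feq.
Proof.
split=> [s|s t|t s u].
- exact/asboolP.
- by apply: asbool_equiv_eq; split=> h P phi /h.
- by move=> /asboolP h1 /asboolP h2; apply/asboolP => P phi c; rewrite h1 ?h2.
Qed.

Canonical feq_rel := EquivRelPack feq_equiv.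

Definition univ : Type := {eq_quot feq_rel}.

HB.instance Definition _ := Choice.on univ.
HB.instance Definition _ : EqQuotient _ feq_rel univ := EqQuotient.on univ.

Lemma univP s t : \pi_univ s = \pi_univ t <->
  forall (P : lmodType A) (phi : X -> P), C phi -> ev phi s = ev phi t.
Proof.
by split=> [/eqmodP/asboolP //|h]; apply/eqmodP/asboolP.
Qed.

Lemma univW (K : univ -> Prop) : (forall s, K (\pi_univ s)) -> forall u, K u.
Proof. by move=> h u; rewrite -[u]reprK. Qed.

Definition uadd (x y : univ) : univ := \pi_univ (repr x ++ repr y).
Definition uscale (a : A) (x : univ) : univ := \pi_univ (fscale a (repr x)).

Lemma ev_repr (P : lmodType A) (phi : X -> P) s : C phi ->
  ev phi (repr (\pi_univ s)) = ev phi s.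
Proof. by move=> c; apply: (univP _ _).1 => //; rewrite reprK. Qed.

Lemma uaddE s t : uadd (\pi_univ s) (\pi_univ t) = \pi_univ (s ++ t).
Proof. by apply/univP => P phi c; rewrite !ev_cat !ev_repr. Qed.

Lemma uscaleE a s : uscale a (\pi_univ s) = \pi_univ (fscale a s).
Proof. by apply/univP => P phi c; rewrite !ev_scale !ev_repr. Qed.

Lemma uaddA : associative uadd.
Proof. by apply: univW => s; apply: univW => t; apply: univW => u; rewrite !uaddE catA. Qed.

Lemma uaddC : commutative uadd.
Proof.
apply: univW => s; apply: univW => t; rewrite !uaddE.
by apply/univP => P phi c; rewrite !ev_cat addrC.
Qed.

Lemma uadd0 : left_id (\pi_univ [::]) uadd.
Proof. by apply: univW => s; rewrite uaddE. Qed.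

Lemma uaddN : left_inverse (\pi_univ [::]) (uscale (-1)) uadd.
Proof.
apply: univW => s; rewrite uscaleE uaddE; apply/univP => P phi c.
by rewrite ev_cat ev_scale scaleN1r addNr /ev big_nil.
Qed.

HB.instance Definition _ := GRing.isZmodule.Build univ uaddA uaddC uadd0 uaddN.

Lemma uscaleA a b x : uscale a (uscale b x) = uscale (a * b) x.
Proof.
move: x; apply: univW => s; rewrite !uscaleE; apply/univP => P phi c.
by rewrite !ev_scale scalerA.
Qed.

Lemma uscale1 : left_id 1 uscale.
Proof.
apply: univW => s; rewrite uscaleE; apply/univP => P phi c.
by rewrite ev_scale scale1r.
Qed.

Lemma uscaleDr : right_distributive uscale +%R.
Proof.
move=> a; apply: univW => s; apply: univW => t.
rewrite /GRing.add /= uaddE !uscaleE uaddE; apply/univP => P phi c.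
by rewrite !(ev_scale, ev_cat) scalerDr.
Qed.

Lemma uscaleDl x : {morph uscale^~ x : a b / a + b}.
Proof.
move: x; apply: univW => s a b; rewrite /= {2}/GRing.add /= !uscaleE uaddE.
by apply/univP => P phi c; rewrite !(ev_scale, ev_cat) scalerDl.
Qed.

HB.instance Definition _ :=
  GRing.Zmodule_isLmodule.Build A univ uscaleA uscale1 uscaleDr uscaleDl.

Definition ugen (x : X) : univ := \pi_univ [:: (1, x)].

Definition ulift_fun (P : lmodType A) (phi : X -> P) (u : univ) : P :=
  ev phi (repr u).

Lemma ulift_linear (P : lmodType A) (phi : X -> P) :
  C phi -> linear (ulift_fun phi).
Proof.
move=> c a; apply: univW => s; apply: univW => t; rewrite /ulift_fun.
rewrite {1}/GRing.scale {1}/GRing.add /= uscaleE uaddE !ev_repr //.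
by rewrite ev_cat ev_scale.
Qed.

Definition ulift (P : lmodType A) (phi : X -> P) (c : C phi) :
  {linear univ -> P} := mklin (ulift_linear c).

Lemma uliftE (P : lmodType A) (phi : X -> P) (c : C phi) x :
  ulift c (ugen x) = phi x.
Proof. by rewrite mklinE /ulift_fun ev_repr // /ev big_seq1 scale1r. Qed.

Lemma pi_sum s : \pi_univ s = \sum_(z <- s) z.1 *: ugen z.2.
Proof.
elim: s => [|[a x] s IH]; first by rewrite big_nil.
rewrite big_cons -IH /= /ugen {1}/GRing.scale {1}/GRing.add /= uscaleE uaddE.
by rewrite /fscale /= mulr1.
Qed.

Lemma univ_ext (P : lmodType A) (f g : univ -> P) :
  linear f -> linear g -> (forall x, f (ugen x) = g (ugen x)) -> f =1 g.
Proof.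
move=> lf lg e u; rewrite -(mklinE lf) -(mklinE lg) -[u]reprK pi_sum.
rewrite !linear_sum; apply: eq_bigr => z _.
by rewrite !linearZ /= !mklinE e.
Qed.

(* Hence [ugen] satisfies every identity that holds for all the maps in [C]: it
   is itself in [C] when [C] is defined by identities; see [tens_bilinear] and
   [wedge_alternating]. *)
Lemma univ_sep (u v : univ) :
  (forall (P : lmodType A) (phi : X -> P) (c : C phi), ulift c u = ulift c v) ->
  u = v.
Proof.
move: u v; apply: univW => s; apply: univW => t h; apply/univP => P phi c.
by have := h P phi c; rewrite !mklinE /ulift_fun !ev_repr.
Qed.

End Universal.

Section Tensor.
Variable A : comPzRingType.

Definition bilinear2 (M N P : lmodType A) (b : M * N -> P) : Prop :=
  (forall y, linear (fun x => b (x, y))) /\ (forall x, linear (fun y => b (x, y))).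

(* The universal property is [tens_bilinear], [tlift], [tliftE], [tensor_ext]. *)
Definition tensor (M N : lmodType A) : lmodType A := univ (@bilinear2 M N).

Definition tens (M N : lmodType A) (x : M) (y : N) : tensor M N :=
  ugen (@bilinear2 M N) (x, y).

Lemma tens_bilinear (M N : lmodType A) :
  bilinear2 (fun z : M * N => tens z.1 z.2).
Proof.
by split=> [y a x x'|x a y y']; apply: univ_sep => P phi c;
  rewrite linearP !uliftE; [apply: c.1 | apply: c.2].
Qed.

Lemma tensPl (M N : lmodType A) a (x x' : M) (y : N) :
  tens (a *: x + x') y = a *: tens x y + tens x' y.
Proof. exact: (tens_bilinear M N).1. Qed.

Lemma tensPr (M N : lmodType A) a (x : M) (y y' : N) :
  tens x (a *: y + y') = a *: tens x y + tens x y'.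
Proof. exact: (tens_bilinear M N).2. Qed.

Lemma tens_linl (M N : lmodType A) (y : N) : linear (fun x : M => tens x y).
Proof. by move=> a x x'; apply: tensPl. Qed.

Lemma tens_linr (M N : lmodType A) (x : M) : linear (fun y : N => tens x y).
Proof. by move=> a y y'; apply: tensPr. Qed.

Definition tlift (M N P : lmodType A) (b : M * N -> P) (hb : bilinear2 b) :
  {linear tensor M N -> P} := ulift hb.

Lemma tliftE (M N P : lmodType A) (b : M * N -> P) (hb : bilinear2 b) x y :
  tlift hb (tens x y) = b (x, y).
Proof. exact: uliftE. Qed.

Lemma tensor_ext (M N P : lmodType A) (f g : tensor M N -> P) :
  linear f -> linear g -> (forall x y, f (tens x y) = g (tens x y)) -> f =1 g.
Proof. by move=> lf lg e; apply: univ_ext => // -[x y]; apply: e. Qed.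

End Tensor.

Section TensorIso.
Variable A : comPzRingType.
Implicit Types M N P : lmodType A.

Lemma tensZl M N a (x : M) (y : N) : tens (a *: x) y = a *: tens x y.
Proof. by rewrite -!(mklinE (tens_linl y)) linearZ. Qed.

Lemma tensZr M N a (x : M) (y : N) : tens x (a *: y) = a *: tens x y.
Proof. by rewrite -!(mklinE (tens_linr x)) linearZ. Qed.

Lemma tens0l M N (y : N) : tens (0 : M) y = 0.
Proof. by rewrite -(mklinE (tens_linl y)) linear0. Qed.

Lemma tens0r M N (x : M) : tens x (0 : N) = 0.
Proof. by rewrite -(mklinE (tens_linr x)) linear0. Qed.

Lemma tensDl M N (x x' : M) (y : N) : tens (x + x') y = tens x y + tens x' y.
Proof. by rewrite -!(mklinE (tens_linl y)) linearD. Qed.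

Lemma tensDr M N (x : M) (y y' : N) : tens x (y + y') = tens x y + tens x y'.
Proof. by rewrite -!(mklinE (tens_linr x)) linearD. Qed.

Lemma tens_suml M N (I : finType) (x : I -> M) (y : N) :
  tens (\sum_i x i) y = \sum_i tens (x i) y.
Proof.
by rewrite -(mklinE (tens_linl y)) linear_sum; apply: eq_bigr => i _; rewrite mklinE.
Qed.

Lemma tens_sumr M N (I : finType) (x : M) (y : I -> N) :
  tens x (\sum_i y i) = \sum_i tens x (y i).
Proof.
by rewrite -(mklinE (tens_linr x)) linear_sum; apply: eq_bigr => i _; rewrite mklinE.
Qed.

Lemma linear_comp M N P (f : M -> N) (g : N -> P) :
  linear f -> linear g -> linear (g \o f).
Proof. by move=> lf lg a x y /=; rewrite lf lg. Qed.

Lemma bilinear_comp M N P (Q : lmodType A) (b : M * N -> P) (f : P -> Q) :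
  bilinear2 b -> linear f -> bilinear2 (f \o b).
Proof.
by move=> [b1 b2] lf; split=> [y a x x'|x a y y'] /=; rewrite ?b1 ?b2 lf.
Qed.

Lemma bilinear_sub M M' N N' P (b : M' * N' -> P) (f : M -> M') (g : N -> N') :
  bilinear2 b -> linear f -> linear g -> bilinear2 (fun z => b (f z.1, g z.2)).
Proof.
by move=> [b1 b2] lf lg; split=> [y a x x'|x a y y'] /=;
  rewrite ?lf ?lg ?b1 ?b2.
Qed.

Lemma bilinear_swap M N P (b : M * N -> P) :
  bilinear2 b -> bilinear2 (fun z => b (z.2, z.1)).
Proof. by case=> b1 b2; split=> [x|y] /=; [apply: b2|apply: b1]. Qed.

Definition tmap M M' N N' (f : {linear M -> M'}) (g : {linear N -> N'}) :
  {linear tensor M N -> tensor M' N'} :=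
  tlift (bilinear_sub (tens_bilinear M' N') (linearP f) (linearP g)).

Lemma tmapE M M' N N' (f : {linear M -> M'}) (g : {linear N -> N'}) x y :
  tmap f g (tens x y) = tens (f x) (g y).
Proof. by rewrite tliftE. Qed.

Lemma tensor_lin_iso M N P (f : {linear tensor M N -> P})
    (g : {linear P -> tensor M N}) :
  (forall x y, g (f (tens x y)) = tens x y) -> cancel g f ->
  lin_iso (tensor M N) P.
Proof.
move=> e gK; exists f; exists g => //.
by apply: tensor_ext => // a u v; rewrite !linearP.
Qed.

Lemma tensor_iso M M' N N' :
  lin_iso M M' -> lin_iso N N' -> lin_iso (tensor M N) (tensor M' N').
Proof.
move=> /lin_isoP[f [f' [lf fK f'K]]] /lin_isoP[g [g' [lg gK g'K]]].
have lf' := cancel_linear lf fK f'K; have lg' := cancel_linear lg gK g'K.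
apply: (tensor_lin_iso (f := tmap (mklin lf) (mklin lg))
                       (g := tmap (mklin lf') (mklin lg'))) => [x y|].
  by rewrite !tmapE !mklinE fK gK.
apply: tensor_ext => [a u v|a u v|x y]; rewrite ?linearP //.
by rewrite !tmapE !mklinE f'K g'K.
Qed.

Lemma tensor_isoC M N : lin_iso (tensor M N) (tensor N M).
Proof.
apply: (tensor_lin_iso (f := tlift (bilinear_swap (tens_bilinear N M)))
  (g := tlift (bilinear_swap (tens_bilinear M N)))) => [x y|].
  by rewrite !tliftE.
by apply: tensor_ext => [a u v|a u v|x y]; rewrite ?linearP // !tliftE.
Qed.

Lemma tensor_iso1 M : lin_iso (tensor A^o M) M.
Proof.
have hb : bilinear2 (fun z : A^o * M => (z.1 : A) *: z.2).
  split=> [y a x x'|x a y y'] /=; first by rewrite scalerDl -scalerA.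
  by rewrite scalerDr !scalerA mulrC.
apply: (tensor_lin_iso (f := tlift hb) (g := mklin (tens_linr (1 : A^o)))) => [x y|x].
  rewrite tliftE mklinE /= tensZr -tensZl.
  by rewrite {1}/GRing.scale /= mulr1.
by rewrite mklinE tliftE /= scale1r.
Qed.

Lemma tensor_iso0 M : lin_iso (tensor 'rV[A]_0 M) 'rV[A]_0.
Proof.
have l0 N P : linear (fun _ : N => 0 : P) by move=> a u v; rewrite scaler0 addr0.
apply: (tensor_lin_iso (f := mklin (l0 _ _)) (g := mklin (l0 _ _))) => [x y|x].
  have -> : x = 0 by apply/rowP; case.
  by rewrite !mklinE tens0l.
by apply/rowP; case.
Qed.

Lemma tensor_isoDl M N P :
  lin_iso (tensor (M * N)%type P) (tensor M P * tensor N P)%type.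
Proof.
have hb : bilinear2 (fun z : (M * N) * P => (tens z.1.1 z.2, tens z.1.2 z.2)).
  by split=> [y a [x1 x2] [x1' x2']|[x1 x2] a y y'] /=; rewrite ?tensPl ?tensPr.
have li1 : linear (fun x : M => (x, 0 : N)).
  by move=> a x y; rewrite /GRing.add /GRing.scale /= /add_pair /= scaler0 addr0.
have li2 : linear (fun x : N => (0 : M, x)).
  by move=> a x y; rewrite /GRing.add /GRing.scale /= /add_pair /= scaler0 addr0.
have lid : linear (@id P) by [].
have lg : linear (fun z : tensor M P * tensor N P =>
    tmap (mklin li1) (mklin lid) z.1 + tmap (mklin li2) (mklin lid) z.2).
  by move=> a z z'; rewrite !linearP scalerDr addrACA.
apply: (tensor_lin_iso (f := tlift hb) (g := mklin lg)) => [[x y] z|[u v]].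
  rewrite tliftE (mklinE lg) /= !tmapE !mklinE.
  rewrite -tensDl.
  by rewrite /GRing.add /= /add_pair /= addr0 add0r.
rewrite (mklinE lg) /= linearD.
have -> : tlift hb (tmap (mklin li1) (mklin lid) u) = (u, 0).
  move: u; apply: tensor_ext => [a u u'|a u u'|x y]; rewrite ?linearP //.
    by rewrite /GRing.add /GRing.scale /= /add_pair /= scaler0 addr0.
  by rewrite tmapE tliftE !mklinE /= tens0l.
have -> : tlift hb (tmap (mklin li2) (mklin lid) v) = (0, v).
  move: v; apply: tensor_ext => [a v v'|a v v'|x y]; rewrite ?linearP //.
    by rewrite /GRing.add /GRing.scale /= /add_pair /= scaler0 addr0.
  by rewrite tmapE tliftE !mklinE /= tens0l.
by rewrite /GRing.add /= /add_pair /= addr0 add0r.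
Qed.

Lemma bilinear_assoc M N P (Q : lmodType A) (t : M -> N -> P -> Q) :
  (forall y z, linear (fun x => t x y z)) ->
  (forall x z, linear (fun y => t x y z)) ->
  (forall x y, linear (fun z => t x y z)) ->
  {h : {linear tensor (tensor M N) P -> Q} |
    forall x y z, h (tens (tens x y) z) = t x y z}.
Proof.
move=> t1 t2 t3.
have hb z : bilinear2 (fun w : M * N => t w.1 w.2 z) by split=> [y|x] /=.
have hc : bilinear2 (fun w : tensor M N * P => tlift (hb w.2) w.1).
  split=> [z|u] /=; first exact: linearP.
  move=> a z z'; move: u; apply: tensor_ext => [b u v|b u v|x y]; rewrite ?linearP //.
    by rewrite /= addrACA !scalerA [b * a]mulrC.
  by rewrite !tliftE /= t3.
by exists (tlift hc) => x y z; rewrite !tliftE.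
Qed.

Lemma tensor_isoA M N P :
  lin_iso (tensor (tensor M N) P) (tensor M (tensor N P)).
Proof.
have [|||f fE] := @bilinear_assoc M N P _ (fun x y z => tens x (tens y z)).
- by move=> y z a x x'; rewrite tensPl.
- by move=> x z a y y'; rewrite tensPl tensPr.
- by move=> x y a z z'; rewrite !tensPr.
have [|||g gE] := @bilinear_assoc N P M _ (fun y z x => tens (tens x y) z).
- by move=> y z a x x'; rewrite tensPr tensPl.
- by move=> x z a y y'; rewrite tensPr.
- by move=> x y a z z'; rewrite !tensPl.
pose s := tlift (bilinear_swap (tens_bilinear (tensor N P) M)).
have lg : linear (g \o s) by move=> a u v /=; rewrite !linearP.
have sE x y : s (tens x y) = tens y x by rewrite tliftE.
exists f; exists (mklin lg).
  apply: tensor_ext => [a u v|a u v|w z]; rewrite ?linearP //.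
  move: w; apply: tensor_ext => [a u v|a u v|x y]; rewrite ?tensPl ?linearP //.
  by rewrite fE mklinE /= sE gE.
apply: tensor_ext => [a u v|a u v|x w]; rewrite ?linearP //.
move: w; apply: tensor_ext => [a u v|a u v|y z]; rewrite ?tensPr ?linearP //.
by rewrite mklinE /= sE gE fE.
Qed.

Lemma fgp_tensor M N : fgp M -> fgp N -> fgp (tensor M N).
Proof.
move=> /fgp_dual_basis[I [v [f fP]]] /fgp_dual_basis[J [w [g gP]]].
apply/fgp_dual_basis.
have hb k : bilinear2 (fun z : M * N => (f k.1 z.1 : A) * (g k.2 z.2 : A) : A^o).
  by split=> [y a x x'|x a y y'] /=; rewrite linearP /= ?mulrDl ?mulrDr
    /GRing.scale /= ?mulrA // [_ * a]mulrC.
exists (I * J)%type, (fun k => tens (v k.1) (w k.2)), (fun k => tlift (hb k)).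
apply: tensor_ext => // [a t t'|x y].
  rewrite scaler_sumr -big_split /=; apply: eq_bigr => k _.
  by rewrite scalerA -scalerDl linearP.
rewrite [in LHS](fP x) tens_suml.
transitivity (\sum_i \sum_j
    (tlift (hb (i, j)) (tens x y) : A) *: tens (v i) (w j)); last first.
  by rewrite pair_bigA; apply: eq_bigr => -[i j].
apply: eq_bigr => i _; rewrite [in LHS](gP y) tens_sumr; apply: eq_bigr => j _.
by rewrite tliftE /= tensZl tensZr scalerA.
Qed.

End TensorIso.

Section Exterior.
Variables (A : comPzRingType) (k : nat).

Definition subst_at (M : Type) (v : {ffun 'I_k -> M}) (i : 'I_k) (x : M) :
  {ffun 'I_k -> M} := [ffun j => if j == i then x else v j].

Definition alternating (M P : lmodType A) (w : {ffun 'I_k -> M} -> P) : Prop :=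
  (forall v i, linear (fun x => w (subst_at v i x))) /\
  (forall (v : {ffun 'I_k -> M}) i j, i != j -> v i = v j -> w v = 0).

(* The universal property is [wedge_alternating], [exterior_lift],
   [exterior_liftE], [exterior_ext]. *)
Definition exterior (M : lmodType A) : lmodType A := univ (@alternating M).

Definition wedge (M : lmodType A) (v : {ffun 'I_k -> M}) : exterior M :=
  ugen (@alternating M) v.

Lemma wedge_alternating (M : lmodType A) : alternating (@wedge M).
Proof.
split=> [v i a x y|v i j ij e]; apply: univ_sep => P phi c.
  by rewrite linearP !uliftE; apply: c.1.
by rewrite linear0 uliftE; apply: c.2 ij e.
Qed.

Definition exterior_lift (M P : lmodType A) (w : {ffun 'I_k -> M} -> P)
  (hw : alternating w) : {linear exterior M -> P} := ulift hw.

Lemma exterior_liftE (M P : lmodType A) (w : {ffun 'I_k -> M} -> P)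
  (hw : alternating w) v : exterior_lift hw (wedge v) = w v.
Proof. exact: uliftE. Qed.

Lemma exterior_ext (M P : lmodType A) (f g : exterior M -> P) :
  linear f -> linear g -> (forall v, f (wedge v) = g (wedge v)) -> f =1 g.
Proof. exact: univ_ext. Qed.

End Exterior.

Section Spectrum.
Variable A : comPzRingType.

Record Spec : Type := PrimeIdeal {
  prime_set :> set A;
  prime0 : prime_set 0;
  primeD : forall x y, prime_set x -> prime_set y -> prime_set (x + y);
  primeMl : forall a x, prime_set x -> prime_set (a * x);
  prime_proper : ~ prime_set 1;
  primeM : forall x y, prime_set (x * y) -> prime_set x \/ prime_set y }.

End Spectrum.

Section Localization.
Variables (A : comPzRingType) (p : Spec A).

Definition den : Type := {s : A | s \notin (p : set A)}.
HB.instance Definition _ := Choice.on den.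

Lemma den1_subproof : (1 : A) \notin (p : set A).
Proof. by rewrite notin_setE; apply: prime_proper. Qed.
Definition den1 : den := exist _ 1 den1_subproof.

Lemma denM_subproof (s t : den) : val s * val t \notin (p : set A).
Proof.
case: s t => [s sp] [t tp] /=; move: sp tp; rewrite !notin_setE => sp tp.
by case/primeM.
Qed.
Definition denM (s t : den) : den := exist _ (val s * val t) (denM_subproof s t).

Definition dval (s : den) : A := val s.

Lemma dval1 : dval den1 = 1. Proof. by []. Qed.

Lemma dvalM s t : dval (denM s t) = dval s * dval t. Proof. by []. Qed.

#[local] Arguments dval : simpl never.

#[local] Ltac dring := do ?[rewrite !dvalM]; rewrite ?dval1 /GRing.scale /=; ring.

Section LocModule.
Variable M : lmodType A.

Definition loc_eq (x y : M * den) : bool :=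
  `[< exists u : den, dval u *: (dval y.2 *: x.1) = dval u *: (dval x.2 *: y.1) >].

Lemma scale_combine (k u s s' c d : A) (x y : M) :
  u *: (s' *: x) = u *: (s *: y) -> c = k * (u * s') -> d = k * (u * s) ->
  c *: x = d *: y.
Proof. by move=> e -> ->; rewrite -!scalerA e. Qed.

Lemma loc_eq_equiv : equiv_class_of loc_eq.
Proof.
split=> [x|x y|y x z].
- by apply/asboolP; exists den1.
- by apply: asbool_equiv_eq; split=> -[u e]; exists u.
- move=> /asboolP[u e] /asboolP[v f]; apply/asboolP.
  exists (denM (denM u v) y.2); rewrite /= !scalerA.
  transitivity ((dval u * dval v * dval x.2 * dval z.2) *: y.1).
    by apply: (scale_combine (k := dval v * dval z.2) e); dring.
  by apply: (scale_combine (k := dval u * dval x.2) f); dring.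
Qed.

Canonical loc_rel := EquivRelPack loc_eq_equiv.

Definition loc : Type := {eq_quot loc_rel}.
HB.instance Definition _ := Choice.on loc.
HB.instance Definition _ : EqQuotient _ loc_rel loc := EqQuotient.on loc.

Definition frac (m : M) (s : den) : loc := \pi_loc (m, s).

Lemma fracP m s n t : frac m s = frac n t <->
  exists u : den, dval u *: (dval t *: m) = dval u *: (dval s *: n).
Proof. by split=> [/eqmodP/asboolP //|h]; apply/eqmodP/asboolP. Qed.

Lemma fracW (K : loc -> Prop) : (forall m s, K (frac m s)) -> forall x, K x.
Proof. by move=> h x; rewrite -[x]reprK; case: (repr x) => m s; apply: h. Qed.

Definition locadd (x y : loc) : loc :=
  frac (dval (repr y).2 *: (repr x).1 + dval (repr x).2 *: (repr y).1)
       (denM (repr x).2 (repr y).2).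

Lemma frac_repr m s : exists u : den,
  dval u *: (dval s *: (repr (frac m s)).1) = dval u *: (dval (repr (frac m s)).2 *: m).
Proof.
by apply/fracP; rewrite {1}/frac -surjective_pairing reprK.
Qed.

Lemma locaddE m s n t :
  locadd (frac m s) (frac n t) = frac (dval t *: m + dval s *: n) (denM s t).
Proof.
rewrite /locadd; have [u e] := frac_repr m s; have [v f] := frac_repr n t.
move: (repr (frac m s)) (repr (frac n t)) e f => [m' s'] [n' t'] /= e f.
apply/fracP; exists (denM u v); rewrite /= !scalerDr !scalerA; congr (_ + _).
  by apply: (scale_combine (k := dval v * dval t * dval t') e); dring.
by apply: (scale_combine (k := dval u * dval s * dval s') f); dring.
Qed.

Lemma frac_eq m s n t : dval t *: m = dval s *: n -> frac m s = frac n t.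
Proof. by move=> e; apply/fracP; exists den1; rewrite e. Qed.

Lemma locaddA : associative locadd.
Proof.
move=> x y z; move: x y z; apply: fracW => m s; apply: fracW => n t.
apply: fracW => q u; rewrite !locaddE; apply: frac_eq => /=.
rewrite !scalerDr !scalerA addrA.
by congr (_ *: _ + _ *: _ + _ *: _); dring.
Qed.

Lemma locaddC : commutative locadd.
Proof.
move=> x y; move: x y; apply: fracW => m s; apply: fracW => n t.
rewrite !locaddE; apply: frac_eq => /=.
by rewrite !scalerDr !scalerA addrC; congr (_ *: _ + _ *: _); dring.
Qed.

Lemma locadd0 : left_id (frac 0 den1) locadd.
Proof.
apply: fracW => m s; rewrite locaddE; apply: frac_eq => /=.
by rewrite scaler0 add0r !scalerA mulrC.
Qed.

Definition locopp (x : loc) : loc := frac (- (repr x).1) (repr x).2.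

Lemma locoppE m s : locopp (frac m s) = frac (- m) s.
Proof.
rewrite /locopp; have [u e] := frac_repr m s.
by apply/fracP; exists u; rewrite !scalerN e.
Qed.

Lemma locaddN : left_inverse (frac 0 den1) locopp locadd.
Proof.
apply: fracW => m s; rewrite locoppE locaddE; apply: frac_eq => /=.
by rewrite scalerN addNr !scaler0.
Qed.

HB.instance Definition _ :=
  GRing.isZmodule.Build loc locaddA locaddC locadd0 locaddN.

Lemma fracD m s n t :
  frac m s + frac n t = frac (dval t *: m + dval s *: n) (denM s t).
Proof. exact: locaddE. Qed.

End LocModule.

(* The action of the localization of [A] on the localization of [M]; the
   multiplication of the localization of [A] is the case [M = A^o]. *)
Definition locscale (M : lmodType A) (a : loc A^o) (x : loc M) : loc M :=
  frac (((repr a).1 : A) *: (repr x).1) (denM (repr a).2 (repr x).2).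

Lemma locscaleE (M : lmodType A) (a : A^o) s (m : M) t :
  locscale (frac a s) (frac m t) = frac ((a : A) *: m) (denM s t).
Proof.
rewrite /locscale; have [u e] := frac_repr a s; have [v f] := frac_repr m t.
move: (repr (frac a s)) (repr (frac m t)) e f => [a' s'] [m' t'] /= e f.
apply/fracP; exists (denM u v) => /=; rewrite !scalerA.
have {}e : dval u * (dval s * a') = dval u * (dval s' * a) by exact: e.
transitivity ((dval u * dval s' * a * dval v * dval t) *: m').
  congr (_ *: _).
  have -> : dval u * dval v * (dval s * dval t) * a' =
    dval u * (dval s * a') * dval v * dval t by dring.
  by rewrite e; dring.
by apply: (scale_combine (k := dval u * dval s' * a) f); dring.
Qed.

Lemma locscaleA (M : lmodType A) a b (x : loc M) :
  locscale a (locscale b x) = locscale (locscale a b) x.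
Proof.
move: a b x; apply: fracW => a s; apply: fracW => b t; apply: fracW => m u.
rewrite (locscaleE b t m u) (locscaleE a s ((b : A) *: m)).
rewrite (locscaleE a s b t) (locscaleE ((a : A) *: b) _ m u).
apply: frac_eq => /=; rewrite !scalerA.
by congr (_ *: _); rewrite {1}/GRing.scale /=; dring.
Qed.

Lemma locscale1 (M : lmodType A) : left_id (frac (1 : A^o) den1) (@locscale M).
Proof.
apply: fracW => m s; rewrite locscaleE; apply: frac_eq => /=.
by rewrite scale1r dvalM dval1 mul1r.
Qed.

Lemma locscaleDr (M : lmodType A) : right_distributive (@locscale M) +%R.
Proof.
move=> a x y; move: a x y; apply: fracW => a s; apply: fracW => m t.
apply: fracW => n u; rewrite (fracD m t n u) !locscaleE fracD; apply: frac_eq => /=.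
rewrite !scalerDr !scalerA.
by congr (_ *: _ + _ *: _); dring.
Qed.

Lemma locscaleDl (M : lmodType A) (x : loc M) :
  {morph @locscale M ^~ x : a b / a + b}.
Proof.
move=> a b; move: a b x; apply: fracW => a s; apply: fracW => b t.
apply: fracW => m u; rewrite (fracD a s b t) !locscaleE fracD; apply: frac_eq => /=.
rewrite !scalerDr !scalerA -scalerDl; congr (_ *: _).
by rewrite /GRing.scale /=; dring.
Qed.

Definition locR : Type := loc A^o.
HB.instance Definition _ := GRing.Zmodule.on locR.

Lemma locmulC : commutative (@locscale A^o : locR -> locR -> locR).
Proof.
move=> x y; move: x y; apply: fracW => a s; apply: fracW => b t.
by rewrite !locscaleE; apply: frac_eq; rewrite /GRing.scale /=; dring.
Qed.

HB.instance Definition _ := GRing.Zmodule_isComPzRing.Build locR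
  (@locscaleA A^o) locmulC (@locscale1 A^o)
  (fun x y z => @locscaleDl A^o z x y).

Definition locM (M : lmodType A) : Type := loc M.

HB.instance Definition _ (M : lmodType A) := GRing.Zmodule.on (locM M).

HB.instance Definition _ (M : lmodType A) :=
  GRing.Zmodule_isLmodule.Build locR (locM M)
    (@locscaleA M) (@locscale1 M) (@locscaleDr M) (@locscaleDl M).

End Localization.

Section Rank.
Variable A : comPzRingType.

(* the rank of the localization at [p], as a module over the local ring at [p];
   the default value 0 is not used on finitely generated projective modules *)
Definition rank (M : lmodType A) (p : Spec A) : nat :=
  xget 0%N [set n | lin_iso (locM p M) 'rV[locR p]_n].

Definition constant_rank (M : lmodType A) (r : nat) : Prop :=
  forall p : Spec A, rank M p = r.

Definition line_bundle_property : Prop :=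
  forall (d : nat) (M : lmodType A), fgp M -> constant_rank M d.+1 ->
  exists n : nat,
    lin_iso ('rV[A]_n * M)%type ('rV[A]_(n + d) * exterior d.+1 M)%type.

End Rank.

Section Grothendieck.
Variable S : comPzSemiRingType.

Definition groth_eq (x y : S * S) : bool :=
  `[< exists k : S, x.1 + y.2 + k = y.1 + x.2 + k >].

Lemma groth_eq_equiv : equiv_class_of groth_eq.
Proof.
split=> [x|x y|y x z].
- by apply/asboolP; exists 0.
- by apply: asbool_equiv_eq; split=> -[u e]; exists u.
- move=> /asboolP[u e] /asboolP[v f]; apply/asboolP.
  exists (y.1 + y.2 + u + v).
  transitivity ((x.1 + y.2 + u) + (y.1 + z.2 + v)); first by ring.
  by rewrite e f; ring.
Qed.

Canonical groth_rel := EquivRelPack groth_eq_equiv.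

Definition groth : Type := {eq_quot groth_rel}.
HB.instance Definition _ := Choice.on groth.
HB.instance Definition _ : EqQuotient _ groth_rel groth := EqQuotient.on groth.

Definition fdiff (a b : S) : groth := \pi_groth (a, b).

Lemma fdiffP a b c d : fdiff a b = fdiff c d <->
  exists k, a + d + k = c + b + k.
Proof. by split=> [/eqmodP/asboolP //|h]; apply/eqmodP/asboolP. Qed.

Lemma fdiffW (K : groth -> Prop) : (forall a b, K (fdiff a b)) -> forall x, K x.
Proof. by move=> h x; rewrite -[x]reprK; case: (repr x) => a b; apply: h. Qed.

Lemma fdiff_repr a b :
  exists k, (repr (fdiff a b)).1 + b + k = a + (repr (fdiff a b)).2 + k.
Proof. by apply/fdiffP; rewrite {1}/fdiff -surjective_pairing reprK. Qed.

Lemma fdiff_eq a b c d : a + d = c + b -> fdiff a b = fdiff c d.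
Proof. by move=> e; apply/fdiffP; exists 0; rewrite e. Qed.

Definition gadd (x y : groth) : groth :=
  fdiff ((repr x).1 + (repr y).1) ((repr x).2 + (repr y).2).

Definition gopp (x : groth) : groth := fdiff (repr x).2 (repr x).1.

Definition gmul (x y : groth) : groth :=
  fdiff ((repr x).1 * (repr y).1 + (repr x).2 * (repr y).2)
        ((repr x).1 * (repr y).2 + (repr x).2 * (repr y).1).

Lemma gaddE a b c d : gadd (fdiff a b) (fdiff c d) = fdiff (a + c) (b + d).
Proof.
rewrite /gadd; have [u e] := fdiff_repr a b; have [v f] := fdiff_repr c d.
move: (repr (fdiff a b)) (repr (fdiff c d)) e f => [a' b'] [c' d'] /= e f.
apply/fdiffP; exists (u + v).
transitivity ((a' + b + u) + (c' + d + v)); first by ring.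
by rewrite e f; ring.
Qed.

Lemma goppE a b : gopp (fdiff a b) = fdiff b a.
Proof.
rewrite /gopp; have [u e] := fdiff_repr a b.
move: (repr (fdiff a b)) e => [a' b'] /= e.
by apply/fdiffP; exists u; rewrite [b' + a]addrC -e [b + a']addrC.
Qed.

Lemma gmulE a b c d :
  gmul (fdiff a b) (fdiff c d) = fdiff (a * c + b * d) (a * d + b * c).
Proof.
rewrite /gmul; have [u e] := fdiff_repr a b; have [v f] := fdiff_repr c d.
move: (repr (fdiff a b)) (repr (fdiff c d)) e f => [a' b'] [c' d'] /= e f.
transitivity (fdiff (a * c' + b * d') (a * d' + b * c')).
  apply/fdiffP; exists (u * c' + u * d').
  transitivity ((a' + b + u) * c' + (a + b' + u) * d'); first by ring.
  transitivity ((a + b' + u) * c' + (a' + b + u) * d'); last by ring.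
  by rewrite e.
apply/fdiffP; exists (a * v + b * v).
transitivity (a * (c' + d + v) + b * (c + d' + v)); first by ring.
transitivity (a * (c + d' + v) + b * (c' + d + v)); last by ring.
by rewrite f.
Qed.

Lemma gaddA : associative gadd.
Proof.
move=> x y z; move: x y z; apply: fdiffW => a b; apply: fdiffW => c d.
by apply: fdiffW => e f; rewrite !gaddE !addrA.
Qed.

Lemma gaddC : commutative gadd.
Proof.
move=> x y; move: x y; apply: fdiffW => a b; apply: fdiffW => c d.
by rewrite !gaddE addrC [b + d]addrC.
Qed.

Lemma gadd0 : left_id (fdiff 0 0) gadd.
Proof. by apply: fdiffW => a b; rewrite gaddE !add0r. Qed.

Lemma gaddN : left_inverse (fdiff 0 0) gopp gadd.
Proof.
by apply: fdiffW => a b; rewrite goppE gaddE; apply: fdiff_eq; rewrite addr0 add0r addrC.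
Qed.

HB.instance Definition _ := GRing.isZmodule.Build groth gaddA gaddC gadd0 gaddN.

Lemma gmulA : associative gmul.
Proof.
move=> x y z; move: x y z; apply: fdiffW => a b; apply: fdiffW => c d.
by apply: fdiffW => e f; rewrite !gmulE; congr fdiff; ring.
Qed.

Lemma gmulC : commutative gmul.
Proof.
move=> x y; move: x y; apply: fdiffW => a b; apply: fdiffW => c d.
by rewrite !gmulE; congr fdiff; ring.
Qed.

Lemma gmul1 : left_id (fdiff 1 0) gmul.
Proof. by apply: fdiffW => a b; rewrite gmulE; congr fdiff; ring. Qed.

Lemma gmulDl : left_distributive gmul +%R.
Proof.
move=> x y z; move: x y z; apply: fdiffW => a b; apply: fdiffW => c d.
apply: fdiffW => e f; rewrite /GRing.add /= gaddE !gmulE gaddE.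
by congr fdiff; ring.
Qed.

HB.instance Definition _ :=
  GRing.Zmodule_isComPzRing.Build groth gmulA gmulC gmul1 gmulDl.

End Grothendieck.

Section Classes.
Variable A : comPzRingType.

Record fgpModule : Type := FgpModule { fgp_sort :> lmodType A; fgpP : fgp fgp_sort }.
Implicit Types M N P : fgpModule.

(* The isomorphism class of a finitely generated module [M] is represented by
   the (small) set of all kernels of surjections from some [A^n] onto [M]; see
   [isoclass_eq]. Using the collection of all modules isomorphic to [M] instead
   would put [K0 A] in too large a universe to be a [comPzRingType]. *)
Definition presentations (M : lmodType A) : set {n : nat & set 'rV[A]_n} :=
  [set c | exists f : {linear 'rV[A]_(projT1 c) -> M},
    (forall y, exists x, f x = y) /\ projT2 c = [set x | f x = 0]%classic].

Definition fgpClass : Type :=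
  {c : set {n : nat & set 'rV[A]_n} | exists M, c = presentations M}.

HB.instance Definition _ := gen_eqMixin fgpClass.
HB.instance Definition _ := gen_choiceMixin fgpClass.

Definition isoclass M : fgpClass := exist _ (presentations M) (ex_intro _ M erefl).

Lemma isoclass_eq M N : isoclass M = isoclass N <-> lin_iso M N.
Proof.
split.
  move=> /(congr1 sval) /= e.
  have [[n [v vP]] _] := fgpP M; have [f fE] := row_lift v.
  have fs y : exists x, f x = y.
    have [c ->] := vP y; exists (\row_i c i); rewrite fE.
    by apply: eq_bigr => i _; rewrite mxE.
  have : presentations M (existT (fun n => set 'rV[A]_n) n [set x | f x = 0]%classic) by exists f.
  rewrite e => -[g /= [gs ker]].
  have fg x y : f x = f y <-> g x = g y.
    have := congr1 (fun K : set _ => K (x - y)) ker => /= {}ker.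
    split=> [h|h]; apply/eqP; rewrite -subr_eq0 -linearB; apply/eqP.
      by rewrite -ker linearB h subrr.
    by rewrite ker linearB h subrr.
  have [s sK] := choice fs; have [t tK] := choice gs.
  apply/lin_isoP; exists (g \o s), (f \o t).
  have e1 x : g (s (f x)) = g x by apply/fg; rewrite sK.
  have e2 x : f (t (g x)) = f x by apply/fg; rewrite tK.
  split=> [a y z|y|y] /=; last 2 first.
  - by rewrite e2 sK.
  - by rewrite e1 tK.
  by rewrite -linearP; apply/fg; rewrite sK linearP !sK.
have sub P Q : lin_iso P Q -> (presentations P `<=` presentations Q)%classic.
  move=> /lin_isoP[f [f' [lf fK f'K]]] [n S] [h /= [hs ->]].
  have lfh : linear (f \o h) by apply: linear_comp => // a x y; rewrite linearP.
  exists (mklin lfh); split=> [y|].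
    by have [x hx] := hs (f' y); exists x; rewrite mklinE /= hx f'K.
  rewrite predeqE => x /=; rewrite mklinE /= -(mklinE lf).
  split=> [->|]; first by rewrite linear0.
  by move/(congr1 f'); rewrite mklinE fK -(fK 0) -(mklinE lf) linear0.
move=> MN; apply: eq_exist; rewrite eqEsubset; split; apply: sub => //.
exact: lin_iso_sym.
Qed.

Definition classrep (c : fgpClass) : fgpModule := projT1 (cid (svalP c)).

Lemma classrepK c : isoclass (classrep c) = c.
Proof.
rewrite /classrep; case: c => c h /=; case: cid => M /= e.
by apply: eq_exist; rewrite e.
Qed.

Lemma classrep_iso M : lin_iso (classrep (isoclass M)) M.
Proof. by apply/isoclass_eq; rewrite classrepK. Qed.

Definition fgp_zero : fgpModule := FgpModule (fgp_row A 0).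
Definition fgp_free (n : nat) : fgpModule := FgpModule (fgp_row A n).
Definition fgp_one : fgpModule := FgpModule (fgp_regular A).
Definition fgp_sum M N : fgpModule := FgpModule (fgp_prod (fgpP M) (fgpP N)).
Definition fgp_tens M N : fgpModule := FgpModule (fgp_tensor (fgpP M) (fgpP N)).

Definition class_add (c d : fgpClass) : fgpClass :=
  isoclass (fgp_sum (classrep c) (classrep d)).

Definition class_mul (c d : fgpClass) : fgpClass :=
  isoclass (fgp_tens (classrep c) (classrep d)).

Lemma class_addE M N : class_add (isoclass M) (isoclass N) = isoclass (fgp_sum M N).
Proof. by apply/isoclass_eq; apply: prod_iso; apply: classrep_iso. Qed.

Lemma class_mulE M N : class_mul (isoclass M) (isoclass N) = isoclass (fgp_tens M N).
Proof. by apply/isoclass_eq; apply: tensor_iso; apply: classrep_iso. Qed.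

Lemma classW (K : fgpClass -> Prop) : (forall M, K (isoclass M)) -> forall c, K c.
Proof. by move=> h c; rewrite -(classrepK c). Qed.

Lemma class_addA : associative class_add.
Proof.
move=> x y z; move: x y z; apply: classW => M; apply: classW => N.
by apply: classW => P; rewrite !class_addE; apply/isoclass_eq; apply: prod_isoA.
Qed.

Lemma class_addC : commutative class_add.
Proof.
move=> x y; move: x y; apply: classW => M; apply: classW => N.
by rewrite !class_addE; apply/isoclass_eq; apply: prod_isoC.
Qed.

Lemma class_add0 : left_id (isoclass fgp_zero) class_add.
Proof.
by apply: classW => M; rewrite class_addE; apply/isoclass_eq; apply: prod_iso0.
Qed.

HB.instance Definition _ :=
  GRing.isNmodule.Build fgpClass class_addA class_addC class_add0.

Lemma class_mulA : associative class_mul.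
Proof.
move=> x y z; move: x y z; apply: classW => M; apply: classW => N.
apply: classW => P; rewrite !class_mulE; apply/isoclass_eq.
by apply: lin_iso_sym; apply: tensor_isoA.
Qed.

Lemma class_mulC : commutative class_mul.
Proof.
move=> x y; move: x y; apply: classW => M; apply: classW => N.
by rewrite !class_mulE; apply/isoclass_eq; apply: tensor_isoC.
Qed.

Lemma class_mul1 : left_id (isoclass fgp_one) class_mul.
Proof.
by apply: classW => M; rewrite class_mulE; apply/isoclass_eq; apply: tensor_iso1.
Qed.

Lemma class_mulDl : left_distributive class_mul class_add.
Proof.
move=> x y z; move: x y z; apply: classW => M; apply: classW => N.
apply: classW => P; rewrite class_addE !class_mulE class_addE.
by apply/isoclass_eq; apply: tensor_isoDl.
Qed.

Lemma class_mul0 : left_zero (isoclass fgp_zero) class_mul.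
Proof.
by apply: classW => M; rewrite class_mulE; apply/isoclass_eq; apply: tensor_iso0.
Qed.

HB.instance Definition _ := GRing.Nmodule_isComPzSemiRing.Build fgpClass
  class_mulA class_mulC class_mul1 class_mulDl class_mul0.

Lemma isoclassD M N : isoclass M + isoclass N = isoclass (fgp_sum M N).
Proof. exact: class_addE. Qed.

Lemma isoclassM M N : isoclass M * isoclass N = isoclass (fgp_tens M N).
Proof. exact: class_mulE. Qed.

Lemma isoclass0 : 0 = isoclass fgp_zero. Proof. by []. Qed.

Lemma isoclass1 : 1 = isoclass fgp_one. Proof. by []. Qed.

End Classes.

Definition K0 (A : comPzRingType) : comPzRingType := groth (fgpClass A).

(* A candidate group: the subset [elts] of the type [carrier], with an operation
   and a neutral element that are defined on the whole type. The group axioms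
   are the content of [is_abelian_group]. *)
Record groupData : Type := GroupData {
  carrier :> Type;
  elts : set carrier;
  op : carrier -> carrier -> carrier;
  neutral : carrier }.

Definition is_abelian_group (G : groupData) : Prop :=
  elts (neutral G) /\
  (forall x y : G, elts x -> elts y -> elts (op x y)) /\
  (forall x y z : G, elts x -> elts y -> elts z -> op x (op y z) = op (op x y) z) /\
  (forall x y : G, elts x -> elts y -> op x y = op y x) /\
  (forall x : G, elts x -> op (neutral G) x = x) /\
  (forall x : G, elts x -> exists y : G, elts y /\ op x y = neutral G).

Definition is_hom (G H : groupData) (f : G -> H) : Prop :=
  (forall x : G, elts x -> elts (f x)) /\
  (forall x y : G, elts x -> elts y -> f (op x y) = op (f x) (f y)).

(* [0 -> G1 -> G2 -> G3 -> 0], with the maps [f] and [g], is a split short exact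
   sequence of abelian groups. *)
Definition split_exact (G1 G2 G3 : groupData) (f : G1 -> G2) (g : G2 -> G3) : Prop :=
  [/\ is_abelian_group G1, is_abelian_group G2 & is_abelian_group G3] /\
  is_hom f /\ is_hom g /\
  (forall x y : G1, elts x -> elts y -> f x = f y -> x = y) /\
  (forall y : G2, elts y ->
    (g y = neutral G3 <-> exists x : G1, elts x /\ f x = y)) /\
  (forall z : G3, elts z -> exists y : G2, elts y /\ g y = z) /\
  (exists s : G3 -> G2, is_hom s /\ forall z : G3, elts z -> g (s z) = z).

Section Sequence.
Variable A : comPzRingType.

Definition Pic : groupData :=
  @GroupData (fgpClass A)
    [set c | exists L : fgpModule A, constant_rank L 1 /\ c = isoclass L]
    *%R 1.

Definition K0_units : groupData :=
  @GroupData (K0 A) [set x | exists y, x * y = 1] *%R 1.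

Definition idempotents : groupData :=
  @GroupData A [set e | e = e ^+ 2] (fun e e' => e + e' - 2%:R * (e * e')) 0.

(* the element [M, N] of [K0 A] *)
Definition K0_diff (M N : fgpModule A) : K0 A := fdiff (isoclass M) (isoclass N).

Definition zero_locus (e : A) : set (Spec A) := [set p | prime_set p e].

Definition rank_one_locus (M N : fgpModule A) : set (Spec A) :=
  [set p | (rank M p)%:Z - (rank N p)%:Z = 1].

Definition is_rank_idempotent (x : K0 A) (e : A) : Prop :=
  e = e ^+ 2 /\
  forall M N : fgpModule A, x = K0_diff M N -> rank_one_locus M N = zero_locus e.

Definition Pic_to_K0 : Pic -> K0_units := fun c : fgpClass A => fdiff c 0.

(* the unique [e] such that [is_rank_idempotent x e] *)
Definition K0_to_idempotents : K0_units -> idempotents :=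
  fun x : K0 A => xget 0 [set e | is_rank_idempotent x e].

End Sequence.

(* Main.v *)
Require Import Defs.
From mathcomp Require Import all_boot all_order all_algebra.
From mathcomp Require Import boolp classical_sets.
From HB Require Import structures.
From mathcomp Require Import ring.
Import GRing.Theory.
(* Gives the [frac] of localizations precedence over that of all_algebra. *)
Import Defs.
Local Open Scope ring_scope.

Set Implicit Arguments.
Unset Strict Implicit.
Unset Printing Implicit Defensive.

(* The rank at a prime p is a ring morphism K0(A) -> Z, so it takes the values 1
   and -1 on units. It is locally constant, so the locus where a unit has rank 1
   is V(e) for an idempotent e, and g is a morphism since the operation on
   idempotents is exclusive or on the loci. If g(x) = 0, write x = [M, A^n];
   then M has constant rank n + 1, and the line bundle property gives
   x = [Lambda^(n+1) M]; here the exterior power is projective of rank 1 because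
   it is a summand of A^k + M. For injectivity, [L] = [L'] gives
   [L (x) L'^-1] = 1, hence L (x) L'^-1 + A^n = A^(n+1) for some n, and
   determinants show that a stably trivial line bundle is trivial. Finally
   e |-> 1 - 2 [eA] is a section of g. *)

(** * Prime ideals *)

Section Primes.
Variable A : comPzRingType.
Implicit Types (p : Spec A) (a b s t : A).
Local Open Scope classical_set_scope.

Definition is_ideal (I : set A) : Prop :=
  [/\ I 0, forall x y, I x -> I y -> I (x + y) & forall a x, I x -> I (a * x)].

(** An ideal maximal among those avoiding [S] is prime: adjoining [x] or [y] from outside it
    produces elements of [S], and the product of these would lie in the ideal if [x * y] did. *)
Lemma prime_avoiding (I S : set A) :
  is_ideal I -> S 1 -> (forall x y, S x -> S y -> S (x * y)) ->
  (forall x, I x -> ~ S x) ->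
  exists p, (forall x, I x -> prime_set p x) /\
    (forall x, prime_set p x -> ~ S x).
Proof.
move=> [I0 ID IM] S1 SM IS.
(* The empty set is admitted because Zorn_bigcup also asks for the union of the
   empty chain; a maximal element is nonempty since it cannot be below I. *)
pose P : set (set A) := [set X |
  [/\ forall x y, X x -> X y -> X (x + y), forall a x, X x -> X (a * x),
      forall x, X x -> ~ S x & forall x y, X x -> I y -> X y]].
have [F FP Ft|J [[JD JM JS JI] Jmax]] := @Zorn_bigcup A P.
  split=> [x y [X FX Xx] [Y FY Yy]|a x [X FX Xx]|x [X FX Xx]|x y [X FX Xx] Iy].
  - have [XY|YX] := Ft X Y FX FY.
      by exists Y => //; have [h _ _ _] := FP _ FY; apply: h => //; apply: XY.
    by exists X => //; have [h _ _ _] := FP _ FX; apply: h => //; apply: YX.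
  - by exists X => //; have [_ h _ _] := FP _ FX; apply: h.
  - by have [_ _ h _] := FP _ FX; apply: h.
  - by exists X => //; have [_ _ _ h] := FP _ FX; apply: h Xx Iy.
have [x0 Jx0] : exists x, J x.
  apply: contrapT => J0; apply: (Jmax I); last by split.
  by split=> [x Jx|IJ]; case: J0; [exists x|exists 0; apply: IJ].
have IJ x : I x -> J x by apply: JI Jx0.
have J0 : J 0 by apply: IJ.
have ext x : ~ J x -> exists y a, J y /\ S (y + a * x).
  move=> nJx; apply: contrapT => h.
  pose K := [set z | exists y a, J y /\ z = y + a * x].
  apply: (Jmax K).
    split=> [y Jy|KJ]; first by exists y, 0; rewrite mul0r addr0.
    by apply: nJx; apply: KJ; exists 0, 1; rewrite mul1r add0r.
  split.
  - move=> _ _ [y [a [Jy ->]]] [z [b [Jz ->]]]; exists (y + z), (a + b).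
    by split; [apply: JD|rewrite mulrDl addrACA].
  - move=> c _ [y [a [Jy ->]]]; exists (c * y), (c * a).
    by split; [apply: JM|rewrite mulrDr mulrA].
  - by move=> _ [y [a [Jy ->]]] Sy; apply: h; exists y, a.
  - by move=> _ y _ Iy; exists y, 0; split; [apply: IJ|rewrite mul0r addr0].
have J1 : ~ J 1 by move=> /JS; apply.
have JP x y : J (x * y) -> J x \/ J y.
  move=> Jxy; apply: contrapT => /not_orP[/ext[z [a [Jz Sz]]] /ext[w [b [Jw Sw]]]].
  have := SM _ _ Sz Sw; apply: JS.
  have -> : (z + a * x) * (w + b * y) =
    (w + b * y) * z + ((a * x) * w + (a * b) * (x * y)) by ring.
  by apply: (JD); [apply: JM|apply: JD; apply: JM].
by exists (PrimeIdeal J0 JD JM J1 JP); split.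
Qed.

(** The case [S = {1}]. This is how local data become global: it is applied below to annihilators,
    to the ideal of two powers and to a sum of ideals given by loci of constant rank. *)
Lemma ideal_prime (I : set A) :
  is_ideal I -> (forall p, exists2 x, I x & ~ prime_set p x) -> I 1.
Proof.
move=> hI h; apply: contrapT => I1.
have [||||p [Ip _]] := @prime_avoiding I [set 1] => //.
- by move=> x y -> ->; rewrite mulr1.
- by move=> x Ix e; apply: I1; rewrite -e.
by have [x /Ip px] := h p.
Qed.

(** If 0 is not a power of [a], some prime avoids all these powers. *)
Lemma nilpotent_prime a : (forall p, prime_set p a) -> exists n, a ^+ n = 0.
Proof.
move=> h; apply: contrapT => na.
have [||||p [_ pS]] := @prime_avoiding [set 0] [set x | exists n, x = a ^+ n].
- by split=> [|_ _ -> ->|b _ ->] //=; rewrite ?addr0 ?mulr0.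
- by exists 0%N; rewrite expr0.
- by move=> _ _ [n ->] [m ->]; exists (n + m)%N; rewrite exprD.
- by move=> _ -> [n e]; apply: na; exists n.
by apply: (pS a) => //; exists 1%N; rewrite expr1.
Qed.

Lemma locally_zero (M : lmodType A) (m : M) :
  (forall p, exists2 s, ~ prime_set p s & s *: m = 0) -> m = 0.
Proof.
move=> h; rewrite -[m]scale1r; apply: (@ideal_prime [set a | a *: m = 0]).
  split=> [|x y|a x] /=; first by rewrite scale0r.
  - by move=> e f; rewrite scalerDl e f addr0.
  - by move=> e; rewrite -scalerA e scaler0.
by move=> p; have [s ps e] := h p; exists s.
Qed.

Lemma prime_notM p s t :
  ~ prime_set p s -> ~ prime_set p t -> ~ prime_set p (s * t).
Proof. by move=> ps pt /primeM[]. Qed.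

Lemma prime_notX p s n : ~ prime_set p s -> ~ prime_set p (s ^+ n).
Proof.
move=> ps; elim: n => [|n IH]; first exact: prime_proper.
by rewrite exprS; apply: prime_notM.
Qed.

Lemma primeN p s : prime_set p s -> prime_set p (- s).
Proof. by rewrite -mulN1r; apply: primeMl. Qed.

Lemma idemC a : a = a ^+ 2 -> 1 - a = (1 - a) ^+ 2.
Proof.
move=> e; have -> : (1 - a) ^+ 2 = 1 - a - (a - a ^+ 2) by ring.
by rewrite -e subrr subr0.
Qed.

Lemma idem_primeC p a : a = a ^+ 2 -> prime_set p (1 - a) <-> ~ prime_set p a.
Proof.
move=> e; split=> [h1 h|na].
  by apply: (@prime_proper _ p); rewrite -[1](subrK a); apply: primeD.
have : prime_set p (a * (1 - a)).
  by rewrite mulrBr mulr1 -expr2 -e subrr; apply: prime0.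
by case/primeM.
Qed.

Lemma idemX a n : a = a ^+ 2 -> a ^+ n.+1 = a.
Proof. by move=> e; elim: n => [|n IH]; rewrite ?expr1 // exprS IH -expr2 -e. Qed.

(** The element [c * (1 - d)] lies in every prime, hence is nilpotent; being idempotent, it
    vanishes. This gives the uniqueness of the idempotent attached to a locus. *)
Lemma idem_prime_inj a b : a = a ^+ 2 -> b = b ^+ 2 ->
  (forall p, prime_set p a <-> prime_set p b) -> a = b.
Proof.
have aux c d : c = c ^+ 2 -> d = d ^+ 2 ->
    (forall p, prime_set p c <-> prime_set p d) -> c = c * d.
  move=> ec ed h; have hp p : prime_set p (c * (1 - d)).
    have [pd|/(idem_primeC p ed).2] := EM (prime_set p d); last exact: primeMl.
    by rewrite mulrC; apply: primeMl; apply/h.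
  have [n] := nilpotent_prime hp.
  (* The extra factor makes the exponent positive, as [idemX] requires. *)
  move/(congr1 (fun z => z * (c * (1 - d)))).
  rewrite mul0r -exprSr idemX; last by rewrite exprMn -ec; congr (_ * _); apply: idemC.
  by rewrite mulrBr mulr1 => /eqP; rewrite subr_eq0 => /eqP.
by move=> ea eb h; rewrite (aux a b) // mulrC -(aux b a) // => p; rewrite h.
Qed.

(** No prime contains both [a] and [b], so none contains both powers. *)
Lemma comaximal_powers a b n :
  a + b = 1 -> exists c d, c * a ^+ n + d * b ^+ n = 1.
Proof.
move=> ab; have [||c [d ->]] := @ideal_prime
    [set x | exists c d, x = c * a ^+ n + d * b ^+ n].
- split=> [|_ _ [c [d ->]] [c' [d' ->]]|x _ [c [d ->]]].
  + by exists 0, 0; rewrite !mul0r addr0.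
  + by exists (c + c'), (d + d'); rewrite !mulrDl addrACA.
  + by exists (x * c), (x * d); rewrite mulrDr !mulrA.
- move=> p; have [pa|pa] := EM (prime_set p a); last first.
    by exists (a ^+ n); [exists 1, 0; rewrite mul1r mul0r addr0|apply: prime_notX].
  exists (b ^+ n); first by exists 0, 1; rewrite mul1r mul0r add0r.
  apply: prime_notX => pb; apply: (@prime_proper _ p); rewrite -ab.
  exact: primeD.
by exists c, d.
Qed.

(** Lifting of idempotents modulo the nilpotent [a * b]: the two terms have sum 1 and product 0,
    which forces them to be idempotent. *)
Lemma idem_lift a b n : a + b = 1 -> (a * b) ^+ n = 0 ->
  exists c d, (c * a ^+ n = (c * a ^+ n) ^+ 2) /\ (c * a ^+ n + d * b ^+ n = 1).
Proof.
move=> ab abn; have [c [d e]] := comaximal_powers n ab; exists c, d; split=> //.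
have z : (c * a ^+ n) * (d * b ^+ n) = 0 by rewrite mulrACA -exprMn abn mulr0.
by rewrite -[LHS]mulr1 -e mulrDr z addr0.
Qed.
End Primes.

(** * Modules up to inverting an element outside a prime *)

Section Kernel.
Variables (A : comPzRingType) (M N : lmodType A) (f : {linear M -> N}).

Definition in_ker : {pred M} := fun m => f m == 0.

Lemma in_ker_submod_closed : submod_closed in_ker.
Proof.
split=> [|a x y /eqP fx /eqP fy]; rewrite unfold_in /in_ker ?linear0 //.
by rewrite linearP fx fy scaler0 addr0.
Qed.

HB.instance Definition _ := GRing.isSubmodClosed.Build A M in_ker in_ker_submod_closed.

(** Kernels provide all the submodules needed: the complement split off by a form, the complement of
    a projective module in a free one, the dual of a line bundle, and the ideal of an idempotent. *)
Record kerM : Type := KerM { ker_val : M; ker_valP : ker_val \in in_ker }.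
HB.instance Definition _ := [isSub for ker_val].
HB.instance Definition _ := [Choice of kerM by <:].
HB.instance Definition _ := [SubChoice_isSubLmodule of kerM by <:].

Lemma ker_val_linear : linear ker_val.
Proof. by move=> a x y. Qed.

Lemma ker_valE (x : kerM) : f (ker_val x) = 0.
Proof. exact/eqP/(ker_valP x). Qed.

Lemma ker_lift (P : lmodType A) (h : P -> M) :
  linear h -> (forall x, f (h x) = 0) ->
  {k : {linear P -> kerM} | forall x, ker_val (k x) = h x}.
Proof.
move=> lh fh; have hP x : h x \in in_ker by rewrite unfold_in /in_ker fh.
have lk : linear (fun x => KerM (hP x)).
  by move=> a x y; apply: val_inj; rewrite /= lh.
by exists (mklin lk) => x; rewrite mklinE.
Qed.

End Kernel.

Section Forms.
Variables (A : comPzRingType) (M : lmodType A).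

Lemma lformP (f : {linear M -> A^o}) a x y :
  (f (a *: x + y) : A) = a * (f x : A) + (f y : A).
Proof. by rewrite linearP. Qed.

Lemma lformZ (f : {linear M -> A^o}) a x : (f (a *: x) : A) = a * (f x : A).
Proof. by rewrite linearZ. Qed.

Lemma mklform (g : M -> A) :
  (forall a x y, g (a *: x + y) = a * g x + g y) ->
  {f : {linear M -> A^o} | forall x, (f x : A) = g x}.
Proof.
move=> lg; have l : linear (g : M -> A^o) by [].
by exists (mklin l) => x; rewrite mklinE.
Qed.

Lemma mklforms (I : Type) (g : I -> M -> A) :
  (forall i a x y, g i (a *: x + y) = a * g i x + g i y) ->
  {f : I -> {linear M -> A^o} | forall i x, (f i x : A) = g i x}.
Proof.
by move=> lg; exists (fun i => sval (mklform (lg i))) => i x; case: (mklform _).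
Qed.

End Forms.

Section LocEquiv.
Variables (A : comPzRingType) (p : Spec A).
Implicit Types M N P : lmodType A.

(* For finitely generated projective modules this amounts to an isomorphism of
   the localizations at p, with denominators cleared. *)
Definition loc_equiv M N : Prop :=
  exists (h : {linear N -> M}) (k : {linear M -> N}) (s : A),
    [/\ ~ prime_set p s, forall x, h (k x) = s *: x & forall y, k (h y) = s *: y].

Lemma lin_iso_loc M N : lin_iso M N -> loc_equiv M N.
Proof.
move=> /lin_isoP[f [g [lf fK gK]]].
exists (mklin (cancel_linear lf fK gK)), (mklin lf), 1.
by split=> [|x|y]; rewrite ?mklinE ?scale1r //; apply: prime_proper.
Qed.

Lemma loc_equiv_sym M N : loc_equiv M N -> loc_equiv N M.
Proof. by move=> [h [k [s [ps hk kh]]]]; exists k, h, s. Qed.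

Lemma loc_equiv_trans M N P : loc_equiv M N -> loc_equiv N P -> loc_equiv M P.
Proof.
move=> [h [k [s [ps hk kh]]]] [h' [k' [s' [ps' hk' kh']]]].
have l1 : linear (h \o h') by move=> a x y; rewrite linearP.
have l2 : linear (k' \o k) by move=> a x y; rewrite linearP.
exists (mklin l1), (mklin l2), (s * s'); split=> [|x|x]; first exact: prime_notM.
  by rewrite !mklinE /= hk' linearZ /= hk scalerA mulrC.
by rewrite !mklinE /= kh linearZ /= kh' scalerA.
Qed.

Lemma loc_equiv_prod M M' N N' :
  loc_equiv M M' -> loc_equiv N N' -> loc_equiv (M * N)%type (M' * N')%type.
Proof.
move=> [h [k [s [ps hk kh]]]] [h' [k' [s' [ps' hk' kh']]]].
(* The multipliers are crossed so that both components are scaled by [s * s']. *)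
have l1 : linear (fun z : M' * N' => (s' *: h z.1, s *: h' z.2)).
  by move=> a x y; apply: injective_projections;
    rewrite /= linearP scalerDr !scalerA mulrC.
have l2 : linear (fun z : M * N => (k z.1, k' z.2)).
  by move=> a x y; apply: injective_projections; rewrite /= linearP.
exists (mklin l1), (mklin l2), (s * s'); split=> [|[x y]|[x y]]; first exact: prime_notM.
  by rewrite !mklinE /= hk hk' !scalerA [s' * s]mulrC.
by rewrite !mklinE /= !linearZ /= kh kh' !scalerA [s' * s]mulrC.
Qed.

Lemma loc_equiv_tensor M M' N N' :
  loc_equiv M M' -> loc_equiv N N' -> loc_equiv (tensor M N) (tensor M' N').
Proof.
move=> [h [k [s [ps hk kh]]]] [h' [k' [s' [ps' hk' kh']]]].
exists (tmap h h'), (tmap k k'), (s * s'); split=> [|t|t]; first exact: prime_notM.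
  move: t; apply: tensor_ext => [a x y|a x y|x y].
  - by rewrite !linearP.
  - by rewrite scalerDr !scalerA mulrC.
  by rewrite !tmapE hk hk' tensZl tensZr scalerA.
move: t; apply: tensor_ext => [a x y|a x y|x y].
- by rewrite !linearP.
- by rewrite scalerDr !scalerA mulrC.
by rewrite !tmapE kh kh' tensZl tensZr scalerA.
Qed.

Lemma row_isoD n : lin_iso (A^o * 'rV[A]_n)%type 'rV[A]_(1 + n).
Proof.
apply/lin_isoP; exists (fun z => row_mx (const_mx (z.1 : A)) z.2).
exists (fun v => (lsubmx v 0 0, rsubmx v)); split=> [a x y|[a y]|v].
- rewrite scale_row_mx add_row_mx; congr row_mx.
  by apply/rowP => i; rewrite !mxE.
- by rewrite row_mxKl row_mxKr !mxE.
- rewrite -[RHS]hsubmxK; congr row_mx; apply/rowP => i.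
  by rewrite ord1 mxE.
Qed.

(* If m is recovered up to s from n functionals, either some vector can be
   eliminated, or one functional is surjective at p and splits off. *)
Lemma loc_free n M (v : 'I_n -> M) (f : 'I_n -> {linear M -> A^o}) (s : A) :
  ~ prime_set p s -> (forall m, s *: m = \sum_i (f i m : A) *: v i) ->
  exists r, loc_equiv M 'rV[A]_r.
Proof.
elim: n M v f s => [|n IH] M v f s ps e.
  have l0 : linear (fun _ : M => 0 : 'rV[A]_0) by move=> a x y; rewrite scaler0 addr0.
  have l1 : linear (fun _ : 'rV[A]_0 => 0 : M) by move=> a x y; rewrite scaler0 addr0.
  exists 0%N, (mklin l1), (mklin l0), s; split=> // [x|y]; rewrite !mklinE.
    by rewrite e big_ord0.
  by apply/rowP; case.
pose w := v ord0; pose g := f ord0; pose v' i := v (lift ord0 i).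
pose f' i := f (lift ord0 i).
have {}e m : s *: m = (g m : A) *: w + \sum_i (f' i m : A) *: v' i.
  by rewrite e big_ord_recl.
have [pc|pc] := EM (prime_set p (g w : A)).
  (* The relation at [w] expresses [u *: w] through the [v'], so [w] is eliminated after multiplying
     by [u], which is outside [p] since [s] is outside and [g w] inside. *)
  pose u := s - (g w : A).
  have pu : ~ prime_set p u.
    by move=> pu; apply: ps; rewrite -[s](subrK (g w : A)); apply: primeD.
  have [|f2 f2E] := @mklforms A M _
    (fun i m => u * (f' i m : A) + (g m : A) * (f' i w : A)).
    by move=> i a x y; rewrite !lformP; ring.
  apply: (IH M v' f2 (u * s)); first exact: prime_notM.
  move=> m; rewrite -scalerA e scalerDr scalerA mulrC -scalerA.
  have -> : u *: w = \sum_i (f' i w : A) *: v' i.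
    by rewrite scalerBl e addrAC subrr add0r.
  rewrite !scaler_sumr -big_split; apply: eq_bigr => i _.
  by rewrite f2E !scalerA scalerDl addrC.
set c := (g w : A) in pc.
(* This is [c] times the projection onto the kernel of [g] along [w], without denominators. *)
have lpi : linear (fun m => c *: m - (g m : A) *: w).
  move=> a x y; rewrite lformP scalerDl scalerDr opprD addrACA scalerBr !scalerA.
  by rewrite [c * a]mulrC.
have [|pi piE] := @ker_lift _ _ _ g _ _ lpi.
  move=> x; rewrite linearB !linearZ /= /GRing.scale /= -/c.
  by rewrite mulrN mulrC subrr.
have [|f2 f2E] := @mklforms A (kerM g) _ (fun i m => f' i (ker_val m)).
  by move=> i a x y; rewrite ker_val_linear lformP.
have [|r [h [k [t [pt hk kh]]]]] :=
    IH (kerM g) (fun i => pi (v' i)) f2 (c * s) (prime_notM pc ps).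
  move=> m; apply: val_inj => /=.
  have := congr1 (fun x => ker_val (pi x)) (e (ker_val m)).
  rewrite ker_valE scale0r add0r linearZ /= => e'.
  transitivity (s *: ker_val (pi (ker_val m))).
    by rewrite piE ker_valE scale0r subr0 scalerA mulrC.
  rewrite e' linear_sum; congr ker_val; apply: eq_bigr => i _.
  by rewrite linearZ f2E.
(* The factor [t] on the first component makes both composites multiplication by [t * c]. *)
have lh : linear (fun z : A^o * 'rV[A]_r => (t * (z.1 : A)) *: w + ker_val (h z.2)).
  move=> a [x1 x2] [y1 y2]; rewrite /= linearP ker_val_linear.
  have -> : t * (a *: x1 + y1) = a * (t * x1) + t * y1 by rewrite mulrDr mulrCA.
  by rewrite scalerDl scalerDr !scalerA addrACA.
have lk : linear (fun m => (g m, k (pi m))).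
  by move=> a x y; apply: injective_projections; rewrite /= !linearP.
exists (1 + r)%N; apply: loc_equiv_trans (lin_iso_loc (row_isoD r)).
exists (mklin lh), (mklin lk), (t * c); split=> [|m|[a y]]; first exact: prime_notM.
  by rewrite !mklinE /= hk /= piE scalerBr !scalerA addrC subrK.
rewrite !mklinE /=; apply: injective_projections => /=.
  by rewrite [LHS]lformP ker_valE addr0 -/c mulrAC.
have -> : pi (t * a *: w + ker_val (h y)) = c *: h y.
  apply: val_inj; rewrite /= piE lformP ker_valE addr0.
  by rewrite scalerDr !scalerA -/c [c * (t * a)]mulrC addrAC subrr add0r.
by rewrite linearZ /= kh scalerA mulrC.
Qed.
End LocEquiv.

(** * The rank *)

Section FreeRank.
Variable R : comPzRingType.

(** Padding both factors with zeros to square matrices makes their determinants vanish. *)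
Lemma scalar_mx_factor n k (s : R) (B : 'M_(n + k.+1, n)) (C : 'M_(n, n + k.+1)) :
  B *m C = s%:M -> s ^+ (n + k.+1) = 0.
Proof.
move=> e; rewrite -det_scalar -e.
have -> : B *m C = row_mx B (0 : 'M_(_, k.+1)) *m col_mx C 0.
  by rewrite mul_row_col mul0mx addr0.
rewrite det_mulmx [\det (col_mx _ _)](expand_det_row _ (rshift n ord0)).
by rewrite big1 ?mulr0 // => j _; rewrite col_mxEd mxE mul0r.
Qed.

(** For [s = 1] this is the invariance of the rank of free modules over a nonzero ring. *)
Lemma row_factor m n (h : {linear 'rV[R]_m -> 'rV[R]_n})
    (k : {linear 'rV[R]_n -> 'rV[R]_m}) (s : R) :
  (forall v, k (h v) = s *: v) -> (n < m)%N -> s ^+ m = 0.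
Proof.
move=> kh; move/subnKC; case: m h k kh => // m h k kh; rewrite subSS => e.
have E : lin1_mx h *m lin1_mx k = s%:M.
  apply/row_matrixP => i; rewrite !rowE mulmxA !mul_rV_lin1 kh.
  by rewrite mul_mx_scalar.
move: h k kh E; rewrite -e addSnnS => h k kh; exact: scalar_mx_factor.
Qed.
End FreeRank.

Lemma fgp_ord_basis (A : comPzRingType) (M : lmodType A) : fgp M ->
  exists n (v : 'I_n -> M) (f : 'I_n -> {linear M -> A^o}),
    forall m, m = \sum_i (f i m : A) *: v i.
Proof.
move=> /fgp_dual_basis[I [v [f fP]]].
exists #|I|, (fun i => v (enum_val i)), (fun i => f (enum_val i)) => m.
rewrite [LHS]fP (reindex (@enum_val I predT)) //=.
exact: onW_bij (enum_val_bij I).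
Qed.

Section LocRank.
Variables (A : comPzRingType) (p : Spec A).
Implicit Types M N : lmodType A.

Lemma locR_neq0 : (1 : locR p) <> 0.
Proof.
move=> /fracP[u]; rewrite !scaler0 => e.
have : dval u \notin (p : set A) by exact: (svalP u).
rewrite notin_setE; apply.
have -> : dval u = dval u *: (dval (den1 p) *: (1 : A^o)).
  by rewrite /GRing.scale /= dval1 !mulr1.
by rewrite e; apply: prime0.
Qed.

Lemma fracDs M (m n : M) (s : den p) : frac m s + frac n s = frac (m + n) s.
Proof.
rewrite fracD; apply: frac_eq.
by rewrite dvalM -scalerDr !scalerA.
Qed.

Lemma frac_sum M n (m : 'I_n -> M) (s : den p) :
  \sum_i frac (m i) s = frac (\sum_i m i) s.
Proof.
apply: (big_ind2 (fun x y => x = frac y s)) => [|x x' y y' -> ->|//].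
  by apply: frac_eq; rewrite !scaler0.
exact: fracDs.
Qed.

Definition loc_coord M (f : {linear M -> A^o}) (x : locM p M) : locR p :=
  frac (f (repr x).1) (repr x).2.

Lemma loc_coordE M (f : {linear M -> A^o}) m s :
  loc_coord f (frac m s : locM p M) = frac (f m) s.
Proof.
have [u e] := frac_repr m s; apply/fracP; exists u => /=.
have e' := congr1 f e; rewrite !lformZ in e'; exact: e'.
Qed.

Lemma loc_coord_linear M (f : {linear M -> A^o}) a (x y : locM p M) :
  loc_coord f (a *: x + y) = a * loc_coord f x + loc_coord f y.
Proof.
move: a x y; apply: fracW => a s; apply: fracW => m t; apply: fracW => n u.
rewrite (loc_coordE f m t) (loc_coordE f n u).
have -> : (frac a s : locR p) *: (frac m t : locM p M) =
    frac ((a : A) *: m) (denM s t).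
  exact: locscaleE.
have -> : (frac a s : locR p) * (frac (f m) t : locR p) =
    frac ((a : A) *: f m) (denM s t).
  exact: locscaleE.
transitivity (frac (f (dval u *: ((a : A) *: m) + dval (denM s t) *: n))
  (denM (denM s t) u)).
  by rewrite -[RHS]loc_coordE; congr (loc_coord f _); apply: fracD.
rewrite (lformP f) (lformZ f a m) (lformZ f _ n).
exact: esym (@fracD A p A^o (a *: f m) (denM s t) (f n) u).
Qed.

(** In the localization [s] is invertible, and [h] divided by [s] becomes inverse to [k]. *)
Lemma loc_equiv_iso M r : loc_equiv p M 'rV[A]_r -> lin_iso (locM p M) 'rV[locR p]_r.
Proof.
move=> [h [k [s [ps hk kh]]]].
have sP : s \notin (p : set A) by rewrite notin_setE.
pose S : den p := exist _ s sP.
have [|f fE] := @mklforms A M 'I_r (fun i m => k m 0 i).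
  by move=> i a x y; rewrite linearP !mxE.
pose F (x : locM p M) : 'rV[locR p]_r := \row_i loc_coord (f i) x.
have lF : linear F by move=> a x y; apply/rowP => i; rewrite !mxE loc_coord_linear.
pose e i : locM p M := frac (h (delta_mx 0 i)) S.
pose G (y : 'rV[locR p]_r) : locM p M := \sum_i y 0 i *: e i.
apply/lin_isoP; exists F, G; split=> // [x|y].
  move: x; apply: fracW => m t.
  have step i : F (frac m t) 0 i *: e i =
      frac ((f i m : A) *: h (delta_mx 0 i)) (denM t S).
    by rewrite mxE loc_coordE; apply: locscaleE.
  rewrite /G (eq_bigr _ (fun i _ => step i)) [LHS]frac_sum.
  have -> : \sum_i (f i m : A) *: h (delta_mx 0 i) = s *: m.
    rewrite -hk [in RHS](row_sum_delta (k m)) linear_sum; apply: eq_bigr => i _.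
    by rewrite linearZ fE.
  by apply: frac_eq; rewrite scalerA dvalM.
rewrite /G -(mklinE lF) linear_sum [RHS]row_sum_delta; apply: eq_bigr => i _.
rewrite linearZ /= mklinE; congr (_ *: _); apply/rowP => j.
rewrite !mxE loc_coordE.
rewrite fE kh mxE mxE eqxx /=; case: eqP => _.
  by apply: frac_eq; rewrite /GRing.scale /= dval1 mulr1 mul1r.
by apply: frac_eq; rewrite /GRing.scale /= !mulr0.
Qed.

(** Ranks are computed through this lemma, without localizing. The value chosen by [rank] is the
    expected one because the localized ring is nonzero, so that the exponent is unique. *)
Lemma rank_loc M r : loc_equiv p M 'rV[A]_r -> rank M p = r.
Proof.
move=> e; have i := loc_equiv_iso e.
suff aux m n : lin_iso 'rV[locR p]_m 'rV[locR p]_n -> (m <= n)%N.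
  apply: xget_unique => //= n j; apply/eqP; rewrite eqn_leq.
  by rewrite !aux //; apply: lin_iso_trans (lin_iso_sym _) _; eassumption.
move=> /lin_isoP[h [k [lh hk kh]]]; rewrite leqNgt; apply/negP => lt.
have lk := cancel_linear lh hk kh.
apply: locR_neq0; rewrite -(expr1n _ m).
by apply: (@row_factor _ _ _ (mklin lh) (mklin lk)) => // v; rewrite !mklinE hk scale1r.
Qed.

Lemma rankP M : fgp M -> loc_equiv p M 'rV[A]_(rank M p).
Proof.
move=> /fgp_ord_basis[n [v [f fP]]].
suff [r e] : exists r, loc_equiv p M 'rV[A]_r by rewrite (rank_loc e).
apply: (@loc_free _ _ n _ v f 1) => [|m]; first exact: prime_proper.
by rewrite scale1r.
Qed.
End LocRank.

(** * The rank on K0 *)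

Section ClassRank.
Variable A : comPzRingType.
Implicit Types (M N : fgpModule A) (p : Spec A) (c d : fgpClass A) (x y : K0 A).

(** Combined with [isoclass_eq], it turns identities between numerals into isomorphisms of free
    modules. *)
Lemma isoclass_free n : isoclass (fgp_free A n) = n%:R.
Proof.
elim: n => [|n IH]; first by [].
rewrite [RHS]mulrS -IH isoclass1 isoclassD.
by apply/isoclass_eq; apply: lin_iso_sym; apply: row_isoD.
Qed.

Lemma rank_iso M N p : lin_iso M N -> rank M p = rank N p.
Proof.
move=> e; apply: rank_loc; apply: loc_equiv_trans (rankP p (fgpP N)).
exact: lin_iso_loc.
Qed.

Lemma rank_free n p : rank 'rV[A]_n p = n.
Proof. by apply: rank_loc; apply: lin_iso_loc; apply: lin_iso_refl. Qed.

Definition class_rank p c : nat := rank (classrep c) p.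

Lemma class_rankE p M : class_rank p (isoclass M) = rank M p.
Proof. exact/rank_iso/classrep_iso. Qed.

Lemma class_rank_nat p n : class_rank p n%:R = n.
Proof. by rewrite -isoclass_free class_rankE rank_free. Qed.

Lemma class_rankD p : {morph class_rank p : c d / c + d >-> (c + d)%N}.
Proof.
move=> c d; move: c d; apply: classW => M; apply: classW => N.
rewrite isoclassD !class_rankE; apply: rank_loc.
apply: loc_equiv_trans (loc_equiv_prod (rankP p (fgpP M)) (rankP p (fgpP N))) _.
apply: lin_iso_loc.
apply/(isoclass_eq (fgp_sum (fgp_free A _) (fgp_free A _)) (fgp_free A _)).
by rewrite -isoclassD !isoclass_free natrD.
Qed.

Lemma class_rankM p : {morph class_rank p : c d / c * d >-> (c * d)%N}.
Proof.
move=> c d; move: c d; apply: classW => M; apply: classW => N.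
rewrite isoclassM !class_rankE; apply: rank_loc.
apply: loc_equiv_trans (loc_equiv_tensor (rankP p (fgpP M)) (rankP p (fgpP N))) _.
apply: lin_iso_loc.
apply/(isoclass_eq (fgp_tens (fgp_free A _) (fgp_free A _)) (fgp_free A _)).
by rewrite -isoclassM !isoclass_free natrM.
Qed.

Definition virtual_rank p x : int :=
  (class_rank p (repr x).1)%:Z - (class_rank p (repr x).2)%:Z.

(** The auxiliary summand in an equality of formal differences has a finite rank, which cancels. *)
Lemma virtual_rankE p c d :
  virtual_rank p (fdiff c d) = (class_rank p c)%:Z - (class_rank p d)%:Z.
Proof.
have [k /(congr1 (fun c => (class_rank p c)%:Z))] := fdiff_repr c d.
rewrite !class_rankD !PoszD => /addIr e; apply/eqP.
by rewrite /virtual_rank subr_eq addrAC eq_sym subr_eq -e.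
Qed.

Lemma virtual_rank1 p : virtual_rank p 1 = 1.
Proof. by rewrite virtual_rankE (class_rank_nat p 1) (class_rank_nat p 0). Qed.

Lemma virtual_rankM p : {morph virtual_rank p : x y / x * y}.
Proof.
move=> x y; move: x y; apply: fdiffW => a b; apply: fdiffW => c d.
have -> : (fdiff a b : K0 A) * fdiff c d = fdiff (a * c + b * d) (a * d + b * c).
  exact: gmulE.
by rewrite !virtual_rankE !class_rankD !class_rankM !PoszD !PoszM; ring.
Qed.

(** The definition quantifies over all ways to write [x] as a difference; since [virtual_rank] does
    not depend on them, a pointwise condition suffices. *)
Lemma is_rank_idempotentE x e : is_rank_idempotent x e <->
  e = e ^+ 2 /\ forall p, virtual_rank p x = 1 <-> prime_set p e.
Proof.
have locus M N p : rank_one_locus M N p = (virtual_rank p (K0_diff M N) = 1).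
  by rewrite virtual_rankE !class_rankE.
split=> -[ee h]; split=> //.
  move=> p; move: x h; apply: fdiffW => c d; rewrite -(classrepK c) -(classrepK d) => h.
  by rewrite -[virtual_rank _ _ = 1]locus (h _ _ erefl).
by move=> M N xE; rewrite predeqE => p; rewrite locus -xE; apply: h.
Qed.

Lemma virtual_rank_unit p x y : x * y = 1 ->
  virtual_rank p x = 1 \/ virtual_rank p x = -1.
Proof.
move=> /(congr1 (virtual_rank p)); rewrite virtual_rankM virtual_rank1 => e.
have : virtual_rank p x \is a GRing.unit.
  by apply/unitrP; exists (virtual_rank p y); rewrite mulrC.
by case/orP=> /eqP; [left|right].
Qed.

(** The maps witnessing the ranks at [p] witness the same ranks at every prime that avoids their
    multipliers. *)
Lemma virtual_rank_locally_constant p x : exists2 s, ~ prime_set p s &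
  forall q, ~ prime_set q s -> virtual_rank q x = virtual_rank p x.
Proof.
move: x; apply: fdiffW; apply: classW => M; apply: classW => N.
have [h [k [s [ps hk kh]]]] := rankP p (fgpP M).
have [h' [k' [s' [ps' hk' kh']]]] := rankP p (fgpP N).
exists (s * s') => [|q qs]; first exact: prime_notM.
rewrite !virtual_rankE !class_rankE.
have -> : rank M q = rank M p.
  apply: rank_loc; exists h, k, s; split=> // qs'; apply: qs.
  by rewrite mulrC; apply: primeMl.
have -> // : rank N q = rank N p.
by apply: rank_loc; exists h', k', s'; split=> // qs'; apply: qs; apply: primeMl.
Qed.

(** The ideal [I r] consists of the elements that vanish wherever the rank is not [r]. As ranks are
    1 or -1, [I 1] and [I (-1)] are comaximal; in [1 = a + b] each prime contains exactly one of [a]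
    and [b], so [a * b] is nilpotent and [idem_lift] applies. *)
Lemma unit_rank_idempotent x y : x * y = 1 -> exists! e, is_rank_idempotent x e.
Proof.
move=> xy; suff [e eP] : exists e, is_rank_idempotent x e.
  exists e; split=> // f fP; have [e2 eq] := (is_rank_idempotentE x e).1 eP.
  have [f2 fq] := (is_rank_idempotentE x f).1 fP.
  by apply: idem_prime_inj => // p; rewrite -eq -fq.
pose I (r : int) : set A :=
  [set a | forall p, ~ prime_set p a -> virtual_rank p x = r]%classic.
have II r : is_ideal (I r).
  split=> [p []|a b Ia Ib p pab|a b Ib p pab]; first exact: prime0.
  - have [pa|/Ia//] := EM (prime_set p a); have [pb|/Ib//] := EM (prime_set p b).
    by case: pab; apply: primeD.
  - by apply: Ib => pb; apply: pab; apply: primeMl.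
have [||a [b [Ia Ib ab]]] := @ideal_prime A
    [set c | exists a b, [/\ I 1 a, I (-1) b & c = a + b]]%classic.
- have [z1 D1 M1] := II 1; have [z2 D2 M2] := II (-1); split=> /=.
  + by exists 0, 0; rewrite addr0.
  + move=> _ _ [a [b [Ia Ib ->]]] [a' [b' [Ia' Ib' ->]]]; exists (a + a'), (b + b').
    by split; [apply: D1|apply: D2|rewrite addrACA].
  + move=> c _ [a [b [Ia Ib ->]]]; exists (c * a), (c * b).
    by split; [apply: M1|apply: M2|rewrite mulrDr].
- move=> p; have [s ps sP] := virtual_rank_locally_constant p x; exists s => //=.
  have [z1 _ _] := II 1; have [z2 _ _] := II (-1).
  case: (virtual_rank_unit p xy) => e; rewrite e in sP.
    by exists s, 0; rewrite addr0.
  by exists 0, s; rewrite add0r.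
have notab p : prime_set p a <-> ~ prime_set p b.
  split=> [pa pb|pb].
    by apply: (@prime_proper _ p); rewrite ab; apply: primeD.
  by apply: contrapT => pa; have := Ia p pa; rewrite (Ib p pb).
have [n ban] : exists n, (b * a) ^+ n = 0.
  apply: nilpotent_prime => p; have [pb|/notab pa] := EM (prime_set p b).
    by rewrite mulrC; apply: primeMl.
  exact: primeMl.
(* A positive exponent ensures that a prime containing [b] contains the idempotent. *)
have [||c [d [ce cd]]] := @idem_lift A b a n.+1; first by rewrite addrC.
  by rewrite exprS ban mulr0.
exists (c * b ^+ n.+1); apply/is_rank_idempotentE; split=> // p; split=> [r1|pe].
  rewrite exprS mulrCA mulrC; apply: primeMl; apply: contrapT => pb.
  by have := Ib p pb; rewrite r1.
apply: Ia => pa; apply: (@prime_proper _ p); rewrite -cd; apply: primeD => //.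
by rewrite exprS mulrCA mulrC; apply: primeMl.
Qed.
End ClassRank.

(** * Line bundles *)

Section Retracts.
Variable A : comPzRingType.
Implicit Types M N P : lmodType A.

Lemma fgp_retract M P (i : {linear M -> P}) (r : {linear P -> M}) :
  cancel i r -> fgp P -> fgp M.
Proof.
move=> iK /fgp_dual_basis[I [v [f fP]]]; apply/fgp_dual_basis.
have [|g gE] := @mklforms A M I (fun k m => f k (i m)).
  by move=> k a x y; rewrite linearP lformP.
exists I, (fun k => r (v k)), g => m.
rewrite -[LHS]iK [X in r X]fP linear_sum; apply: eq_bigr => k _.
by rewrite linearZ gE.
Qed.

Lemma fgp_iso M N : lin_iso M N -> fgp M -> fgp N.
Proof.
move=> /lin_isoP[f [g [lf fK gK]]].
apply: (@fgp_retract _ _ (mklin (cancel_linear lf fK gK)) (mklin lf)) => x.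
by rewrite !mklinE.
Qed.

Lemma fgp_summand M N : fgp (M * N)%type -> fgp N.
Proof.
have li : linear (fun y : N => (0 : M, y)).
  by move=> a x y; apply: injective_projections; rewrite //= scaler0 addr0.
have lr : linear (fun z : M * N => z.2) by move=> a x y.
by apply: (@fgp_retract _ _ (mklin li) (mklin lr)) => y; rewrite !mklinE.
Qed.

(** A dual basis splits a surjection from a free module, and the kernel is the complement. In [K0]
    this allows subtracted and auxiliary modules to be made free. *)
Lemma fgp_complement (M : fgpModule A) :
  exists (N : fgpModule A) n, isoclass M + isoclass N = n%:R.
Proof.
have [n [v [f fP]]] := fgp_ord_basis (fgpP M).
have [h hE] := row_lift v.
pose g m := \row_i (f i m : A).
have lg : linear g by move=> a x y; apply/rowP => i; rewrite !mxE lformP.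
have hg m : h (g m) = m.
  by rewrite hE [RHS]fP; apply: eq_bigr => i _; rewrite mxE.
have [||k kE] := @ker_lift _ _ _ h _ (fun c => c - g (h c)).
- by move=> a x y; rewrite linearP lg scalerBr opprD addrACA.
- by move=> c; rewrite linearB hg subrr.
have e : lin_iso (M * kerM h)%type 'rV[A]_n.
  apply/lin_isoP; exists (fun z => g z.1 + ker_val z.2), (fun c => (h c, k c)).
  split=> [a [x1 x2] [y1 y2]|[m c]|c] /=.
  - by rewrite lg scalerDr addrACA.
  - congr pair; first by rewrite linearD hg ker_valE addr0.
    by apply: val_inj; rewrite /= kE linearD hg ker_valE addr0 addrC addKr.
  - by rewrite kE addrC subrK.
have fN : fgp (kerM h).
  by apply: fgp_summand; apply: fgp_iso (fgp_row A n); apply: lin_iso_sym e.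
exists (FgpModule fN), n; rewrite -isoclass_free isoclassD.
exact/(isoclass_eq (fgp_sum M (FgpModule fN)) (fgp_free A n)).
Qed.

End Retracts.

Section RankOne.
Variables (A : comPzRingType) (L : lmodType A).
Hypothesis L1 : forall p, loc_equiv p L 'rV[A]_1.

(** Near each prime [L] is generated by one element, and both sides are the same product of
    coordinates with the value of [f] at that generator. *)
Lemma rank1_swap (f : {linear L -> A^o}) x y : (f x : A) *: y = (f y : A) *: x.
Proof.
apply/eqP; rewrite -subr_eq0; apply/eqP; apply: locally_zero => p.
have [h [k [s [ps hk kh]]]] := L1 p; exists (s * s); first exact: prime_notM.
have kE z : s *: z = k z 0 0 *: h (const_mx 1).
  rewrite -hk -linearZ; congr (h _); apply/rowP => i.
  by rewrite ord1 !mxE mulr1.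
have fE z : s * (f z : A) = k z 0 0 * (f (h (const_mx 1)) : A).
  by rewrite -!lformZ kE.
have E z t : (s * s) *: ((f z : A) *: t) = (s * (f z : A)) *: (s *: t).
  by rewrite !scalerA; congr (_ *: _); ring.
apply/eqP; rewrite scalerBr subr_eq0 !E !fE !kE !scalerA; apply/eqP.
by congr (_ *: _); ring.
Qed.

(** The sum is the trace of the identity, which is the rank; it is computed near each prime with the
    local generator [w]. *)
Lemma rank1_trace n (v : 'I_n -> L) (f : 'I_n -> {linear L -> A^o}) :
  (forall m, m = \sum_i (f i m : A) *: v i) -> \sum_i (f i (v i) : A) = 1.
Proof.
move=> fP; apply/eqP; rewrite -subr_eq0; apply/eqP.
apply: (@locally_zero A A^o) => p.
have [h [k [s [ps hk kh]]]] := L1 p; exists s => //.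
have kE z : s *: z = k z 0 0 *: h (const_mx 1).
  rewrite -hk -linearZ; congr (h _); apply/rowP => i.
  by rewrite ord1 !mxE mulr1.
pose w := h (const_mx 1).
suff E : s * (\sum_i (f i (v i) : A)) = s.
  by rewrite /GRing.scale /= mulrBr mulr1 E subrr.
transitivity (k w 0 0); last by rewrite kh !mxE mulr1.
rewrite mulr_sumr [in RHS](fP w) linear_sum summxE; apply: eq_bigr => i _.
by rewrite linearZ !mxE -lformZ kE lformZ mulrC.
Qed.
End RankOne.

Section RankOneDual.
Variables (A : comPzRingType) (L : fgpModule A).
Hypothesis L1 : constant_rank L 1.

Lemma rank1_loc p : loc_equiv p L 'rV[A]_1.
Proof. by have := rankP p (fgpP L); rewrite L1. Qed.

(* The dual of L is realized inside A^n by c |-> (m |-> sum_i c_i f_i(m)), as the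
   fixed space of the transpose of the idempotent matrix f_i(v_j). *)
Lemma rank1_inverse :
  exists L' : fgpModule A, constant_rank L' 1 /\ isoclass L * isoclass L' = 1.
Proof.
have [n [v [f fP]]] := fgp_ord_basis (fgpP L).
pose phi (c : 'rV[A]_n) m := \sum_i c 0 i * (f i m : A).
have phiP c a x y : phi c (a *: x + y) = a * phi c x + phi c y.
  rewrite /phi mulr_sumr -big_split /=; apply: eq_bigr => i _.
  by rewrite lformP; ring.
have phiPl a c d m : phi (a *: c + d) m = a * phi c m + phi d m.
  rewrite /phi mulr_sumr -big_split /=; apply: eq_bigr => i _.
  by rewrite !mxE; ring.
have lker : linear (fun c : 'rV[A]_n => c - \row_j phi c (v j)).
  move=> a c d; apply/rowP => j; rewrite !mxE phiPl; ring.
pose K := kerM (mklin lker).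
(* An element of [K] lists the values at the [v j] of the form that it represents. *)
have KE (c : K) j : phi (ker_val c) (v j) = ker_val c 0 j.
  have := congr1 (fun r : 'rV_n => r 0 j) (ker_valE c).
  rewrite /= mklinE !mxE => /eqP.
  by rewrite subr_eq0 => /eqP.
have trans i m : \sum_j (f i (v j) : A) * (f j m : A) = f i m.
  rewrite [in RHS](fP m) linear_sum; apply: eq_bigr => j _.
  by rewrite lformZ mulrC.
pose u0 i : 'rV[A]_n := \row_j (f i (v j) : A).
have u0K i : u0 i \in in_ker (mklin lker).
  rewrite unfold_in /in_ker mklinE; apply/eqP/rowP => j; rewrite !mxE.
  rewrite [X in _ - X](_ : _ = f i (v j)) ?subrr // -trans.
  by apply: eq_bigr => l _; rewrite mxE.
pose u i : K := KerM (u0K i).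
have fK : fgp K.
  apply/fgp_dual_basis; have [|g gE] := @mklforms A K 'I_n (fun i c => ker_val c 0 i).
    by move=> i a x y; rewrite ker_val_linear !mxE.
  exists 'I_n, u, g => c; apply: val_inj; apply/rowP => j.
  rewrite -[LHS]KE /phi.
  rewrite (raddf_sum (val : K -> 'rV[A]_n)).
  by rewrite summxE; apply: eq_bigr => i _; rewrite gE !mxE.
have hb : bilinear2 (fun z : L * K => phi (ker_val z.2) z.1 : A^o).
  split=> [y a x x'|x a y y'] /=; first exact: phiP.
  by rewrite phiPl.
have tr : \sum_i (f i (v i) : A) = 1 by apply: rank1_trace fP => p; apply: rank1_loc.
have iso : lin_iso (tensor L K) A^o.
  (* The inverse of the evaluation pairing sends 1 to the tensor of the identity of [L], whose
     evaluation is the trace 1. *)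
  have lg : linear (fun a : A^o => (a : A) *: \sum_i tens (v i) (u i)).
    by move=> a x y; rewrite scalerDl scalerA.
  apply: (tensor_lin_iso (f := tlift hb) (g := mklin lg)) => [x c|a].
    rewrite tliftE mklinE /=.
    have [g gE] := mklform (phiP (ker_val c)).
    rewrite -gE scaler_sumr.
    rewrite (eq_bigr (fun i => tens x (ker_val c 0 i *: u i))) => [|i _].
      rewrite -tens_sumr; congr tens; apply: val_inj; apply/rowP => j.
      rewrite (raddf_sum (val : K -> 'rV[A]_n)) -[RHS]KE /phi.
      by rewrite summxE; apply: eq_bigr => i _; rewrite !mxE.
    by rewrite -tensZl (rank1_swap rank1_loc) tensZl -tensZr gE KE.
  rewrite mklinE linearZ linear_sum /=.
  rewrite (eq_bigr (fun i => f i (v i) : A)) => [|i _].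
    by rewrite tr /GRing.scale /= mulr1.
  by rewrite tliftE /= -[RHS]trans; apply: eq_bigr => j _; rewrite mxE.
have LL : isoclass L * isoclass (FgpModule fK) = 1.
  rewrite isoclassM isoclass1.
  exact/(isoclass_eq (fgp_tens L (FgpModule fK)) (fgp_one A)).
exists (FgpModule fK); split=> // p.
have := congr1 (class_rank p) LL.
by rewrite class_rankM (class_rank_nat p 1) !class_rankE L1 mul1n.
Qed.
End RankOneDual.

Section StablyTrivial.
Variable A : comPzRingType.

(** This is the linear form whose coefficients are the signed maximal minors of [C]. *)
Definition det_row0 n (C : 'M[A]_(n, 1 + n)) (v : 'rV[A]_(1 + n)) : A :=
  \det (col_mx v C).

Lemma det_row0P n (C : 'M[A]_(n, 1 + n)) a x y :
  det_row0 C (a *: x + y) = a * det_row0 C x + det_row0 C y.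
Proof.
have r (v : 'rV[A]_(1 + n)) : row (lshift n ord0) (col_mx v C) = v.
  by rewrite rowKu row_id.
have r' (v w : 'rV[A]_(1 + n)) :
    row' (lshift n ord0) (col_mx v C) = row' (lshift n ord0) (col_mx w C).
  apply/matrixP => i j; rewrite !mxE; case: splitP => // k e.
  by case: k e => -[].
have -> : a * det_row0 C x + det_row0 C y =
    a * det_row0 C x + 1 * det_row0 C y by rewrite mul1r.
by apply: determinant_multilinear (r' _ _) (r' _ _); rewrite !r scale1r.
Qed.

(* If C is a section of the projection B, the isomorphism L + A^n = A^(1 + n)
   recovers x in L from the number det(x; C) and the vector of maximal minors of
   B, since det(x; C) det(y, B) = x y for every column y. *)
Lemma stably_trivial (L : fgpModule A) n :
  constant_rank L 1 -> lin_iso (L * 'rV[A]_n)%type 'rV[A]_(1 + n) -> lin_iso L A^o.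
Proof.
move=> L1 /lin_isoP[t [ti [lt tK tiK]]]; have lti := cancel_linear lt tK tiK.
have lB : linear (fun x => (ti x).2) by move=> a x y; rewrite lti.
have lC : linear (fun y : 'rV[A]_n => t (0 : L, y)).
  move=> a x y; rewrite -lt; congr t; apply: injective_projections => //=.
  by rewrite scaler0 addr0.
have lj : linear (fun x : L => t (x, 0 : 'rV[A]_n)).
  move=> a x y; rewrite -lt; congr t; apply: injective_projections => //=.
  by rewrite scaler0 addr0.
pose B := lin1_mx (mklin lB); pose C := lin1_mx (mklin lC); pose j := mklin lj.
have CB : C *m B = 1%:M.
  apply/row_matrixP => i.
  by rewrite !rowE mulmxA !mul_rV_lin1 !mklinE tK mulmx1.
have jB x : j x *m B = 0 by rewrite mul_rV_lin1 !mklinE tK.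
(* The matrix with rows [j x] and [C], times the matrix with columns [y] and [B], is block lower
   triangular with lower right block 1, because [j x *m B = 0] and [C *m B = 1]. *)
have det_jC x (y : 'rV[A]_(1 + n)) :
    (j x *m y^T) 0 0 = det_row0 C (j x) * det_row0 B^T y.
  rewrite /det_row0 -[\det (col_mx y _)]det_tr tr_col_mx trmxK -det_mulmx.
  by rewrite mul_col_row jB CB det_lblock det_mx11 det1 mulr1.
pose u : 'rV[A]_(1 + n) := \row_i det_row0 B^T (delta_mx 0 i).
have jE x : j x = det_row0 C (j x) *: u.
  by apply/rowP => i; rewrite !mxE -det_jC trmx_delta -colE mxE.
pose w := (ti u).1.
have lF : linear (fun x : L => det_row0 C (j x) : A^o).
  by move=> a x y; rewrite linearP det_row0P.
have xE x : x = det_row0 C (j x) *: w.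
  have := congr1 (fun v => (ti v).1) (jE x).
  by rewrite /= mklinE tK /= -(mklinE lti) linearZ /= mklinE.
(* By [xE], the vector [w] and the form [det_row0 C \o j] are a dual basis with a single element. *)
have tr : det_row0 C (j w) = 1.
  have := @rank1_trace A L (rank1_loc L1) 1 (fun=> w) (fun=> mklin lF).
  by rewrite big_ord1 mklinE; apply=> m; rewrite big_ord1 mklinE.
apply/lin_isoP; exists (fun x => det_row0 C (j x)), (fun a : A^o => (a : A) *: w).
split=> // a; rewrite -(mklinE lF) linearZ /= mklinE tr.
by rewrite /GRing.scale /= mulr1.
Qed.
End StablyTrivial.

(** * Modules generated by an idempotent *)

Section IdempotentModules.
Variable A : comPzRingType.
Implicit Types (e f : A) (p : Spec A).

Lemma mul_linear (a : A) : linear (fun x : A^o => a * (x : A) : A^o).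
Proof. by move=> b x y; rewrite mulrDr /GRing.scale /= mulrCA. Qed.

(* For idempotent e this is the ideal eA. *)
Definition idem_mod e : lmodType A := kerM (mklin (mul_linear (1 - e))).

Lemma idem_modP e (x : idem_mod e) : e * (ker_val x : A) = ker_val x.
Proof.
have := ker_valE x; rewrite mklinE mulrBl mul1r => /eqP.
by rewrite subr_eq0 => /eqP.
Qed.

Lemma idem_mod_lift e (P : lmodType A) (h : P -> A^o) : linear h ->
  (forall x, e * (h x : A) = h x) ->
  {k : {linear P -> idem_mod e} | forall x, ker_val (k x) = h x}.
Proof.
move=> lh eh; apply: ker_lift => // x.
by rewrite mklinE mulrBl mul1r eh subrr.
Qed.

Lemma idem_mod1 : lin_iso (idem_mod 1) A^o.
Proof.
have [||k kE] := @idem_mod_lift 1 A^o id; [by []|by move=> x; rewrite mul1r|].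
apply/lin_isoP; exists (fun x => ker_val x), k; split=> [|x|x].
- exact: ker_val_linear.
- by apply: val_inj; rewrite /= kE.
- by rewrite kE.
Qed.

Lemma idem_modD e f : e = e ^+ 2 -> f = f ^+ 2 -> e * f = 0 ->
  lin_iso (idem_mod e * idem_mod f)%type (idem_mod (e + f)).
Proof.
move=> ee ff ef.
have [||ke keE] := @idem_mod_lift e (idem_mod (e + f)) (fun x => e * (ker_val x : A)).
- by move=> a x y; rewrite ker_val_linear mul_linear.
- by move=> x; rewrite mulrA -expr2 -ee.
have [||kf kfE] := @idem_mod_lift f (idem_mod (e + f)) (fun x => f * (ker_val x : A)).
- by move=> a x y; rewrite ker_val_linear mul_linear.
- by move=> x; rewrite mulrA -expr2 -ff.
have xf (x : idem_mod e) : f * (ker_val x : A) = 0.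
  by rewrite -(idem_modP x) mulrA [f * e]mulrC ef mul0r.
have ye (y : idem_mod f) : e * (ker_val y : A) = 0.
  by rewrite -(idem_modP y) mulrA ef mul0r.
have [||k kE] := @idem_mod_lift (e + f) (idem_mod e * idem_mod f)%type
    (fun z => (ker_val z.1 : A) + (ker_val z.2 : A)).
- by move=> a [x1 x2] [y1 y2]; rewrite /= scalerDr addrACA.
- by move=> [x y]; rewrite /= mulrDl !mulrDr xf ye !idem_modP addr0 add0r.
apply/lin_isoP; exists k, (fun z => (ke z, kf z)); split=> [|[x y]|z].
- by move=> a x y; rewrite linearP.
- congr pair; apply: val_inj; rewrite /= ?keE ?kfE kE /= mulrDr.
    by rewrite ye idem_modP addr0.
  by rewrite xf idem_modP add0r.
- by apply: val_inj; rewrite /= kE /= keE kfE -mulrDl idem_modP.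
Qed.

Lemma fgp_idem_mod e : e = e ^+ 2 -> fgp (idem_mod e).
Proof.
move=> ee; apply: (@fgp_summand _ (idem_mod (1 - e))).
have o : (1 - e) * e = 0 by rewrite mulrBl mul1r -expr2 -ee subrr.
have /lin_iso_sym/fgp_iso := idem_modD (idemC ee) ee o; apply.
by rewrite subrK; apply: fgp_iso (fgp_regular A); apply: lin_iso_sym idem_mod1.
Qed.

(* The value 0 is only taken when eA is not projective, in particular never for
   an idempotent e. *)
Definition idem_class e : fgpClass A :=
  if pselect (fgp (idem_mod e)) is left h then isoclass (FgpModule h) else 0.

Lemma idem_classE e (h : fgp (idem_mod e)) : idem_class e = isoclass (FgpModule h).
Proof.
rewrite /idem_class; case: pselect => // h'.
by apply/isoclass_eq; apply: lin_iso_refl.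
Qed.

Lemma idem_class1 : idem_class 1 = 1.
Proof.
have h : fgp (idem_mod 1) by apply: fgp_idem_mod; rewrite expr1n.
rewrite (idem_classE h) isoclass1.
exact/(isoclass_eq (FgpModule h) (fgp_one A))/idem_mod1.
Qed.

Lemma idem_classD e f : e = e ^+ 2 -> f = f ^+ 2 -> e * f = 0 ->
  idem_class (e + f) = idem_class e + idem_class f.
Proof.
move=> ee ff ef; have he := fgp_idem_mod ee; have hf := fgp_idem_mod ff.
have i := idem_modD ee ff ef; have hef := fgp_iso i (fgp_prod he hf).
rewrite (idem_classE he) (idem_classE hf) (idem_classE hef) isoclassD.
by apply/(isoclass_eq (FgpModule hef) (fgp_sum (FgpModule he) (FgpModule hf)));
  apply: lin_iso_sym.
Qed.

(** Every tensor of [x] and [y] equals that of [e *: x] and [f *: y], hence is a multiple of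
    [e * f]. *)
Lemma idem_classM0 e f : e = e ^+ 2 -> f = f ^+ 2 -> e * f = 0 ->
  idem_class e * idem_class f = 0.
Proof.
move=> ee ff ef; have he := fgp_idem_mod ee; have hf := fgp_idem_mod ff.
rewrite (idem_classE he) (idem_classE hf) isoclassM isoclass0.
apply/(isoclass_eq (fgp_tens (FgpModule he) (FgpModule hf)) (fgp_zero A)) => /=.
have l0 (M N : lmodType A) : linear (fun _ : M => 0 : N).
  by move=> a x y; rewrite scaler0 addr0.
apply: (tensor_lin_iso (f := mklin (l0 _ _)) (g := mklin (l0 _ _))) => [x y|v].
  rewrite mklinE.
  have -> : x = e *: x by apply: val_inj; rewrite /= -[LHS]idem_modP.
  have -> : y = f *: y by apply: val_inj; rewrite /= -[LHS]idem_modP.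
  by rewrite tensZl tensZr scalerA ef scale0r.
by apply/rowP; case.
Qed.

(** Splitting [e] and [f] into the orthogonal pieces [e * f], [e * (1 - f)] and [f * (1 - e)] leaves
    only the square of the class of [e * f]. That class is idempotent, being orthogonal to its
    complement in 1. *)
Lemma idem_classM e f : e = e ^+ 2 -> f = f ^+ 2 ->
  idem_class e * idem_class f = idem_class (e * f).
Proof.
move=> ee ff.
have he : e * (1 - e) = 0 by rewrite mulrBr mulr1 -expr2 -ee subrr.
have hf : f * (1 - f) = 0 by rewrite mulrBr mulr1 -expr2 -ff subrr.
have ib : e * f = (e * f) ^+ 2 by rewrite exprMn -ee -ff.
have ia : e * (1 - f) = (e * (1 - f)) ^+ 2 by rewrite exprMn -ee -idemC.
have ic : f * (1 - e) = (f * (1 - e)) ^+ 2 by rewrite exprMn -ff -idemC.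
have -> : idem_class e = idem_class (e * f) + idem_class (e * (1 - f)).
  rewrite -idem_classD //; last by rewrite mulrACA hf mulr0.
  by rewrite -mulrDr addrC subrK mulr1.
have -> : idem_class f = idem_class (e * f) + idem_class (f * (1 - e)).
  rewrite -idem_classD //; last by rewrite [e * f]mulrC mulrACA he mulr0.
  by rewrite [e * f]mulrC -mulrDr addrC subrK mulr1.
have bc : e * f * (f * (1 - e)) = 0 by rewrite [e * f]mulrC mulrACA he mulr0.
have ab : e * (1 - f) * (e * f) = 0 by rewrite mulrC mulrACA hf mulr0.
have ac : e * (1 - f) * (f * (1 - e)) = 0.
  by rewrite mulrACA [(1 - f) * _]mulrC mulrACA he mul0r.
have b1 : e * f * (1 - e * f) = 0 by rewrite mulrBr mulr1 -expr2 -ib subrr.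
have bb : idem_class (e * f) * idem_class (e * f) = idem_class (e * f).
  have o : idem_class (e * f + (1 - e * f)) = 1.
    by rewrite addrC subrK idem_class1.
  rewrite -[RHS]mulr1 -o (idem_classD ib (idemC ib) b1) mulrDr.
  by rewrite (idem_classM0 ib (idemC ib) b1) addr0.
move: bb (idem_classM0 ib ic bc) (idem_classM0 ia ib ab) (idem_classM0 ia ic ac).
set a := idem_class (e * (1 - f)); set b := idem_class (e * f).
set c := idem_class (f * _) => E1 E2 E3 E4.
by rewrite mulrDl !mulrDr E1 E2 E3 E4 !addr0.
Qed.

(** If [e] is in [p], then [1 - e] is outside and kills eA; otherwise multiplication by [e]
    identifies eA with A near [p]. *)
Lemma class_rank_idem p e : e = e ^+ 2 ->
  (prime_set p e -> class_rank p (idem_class e) = 0%N) /\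
  (~ prime_set p e -> class_rank p (idem_class e) = 1%N).
Proof.
move=> ee; have he := fgp_idem_mod ee; rewrite (idem_classE he) class_rankE /=.
have l0 (M N : lmodType A) : linear (fun _ : M => 0 : N).
  by move=> a x y; rewrite scaler0 addr0.
split=> pe; apply: rank_loc.
  exists (mklin (l0 _ _)), (mklin (l0 _ _)), (1 - e); split=> [/(idem_primeC p ee)//|x|y].
    rewrite !mklinE; apply: val_inj.
    by rewrite /= /GRing.scale /= mulrBl mul1r idem_modP subrr.
  by apply/rowP; case.
apply: loc_equiv_trans (_ : loc_equiv p A^o _); last first.
  apply: lin_iso_loc; apply/(isoclass_eq (fgp_one A) (fgp_free A 1)).
  by rewrite isoclass_free.
have [||k kE] := @idem_mod_lift e A^o (fun x => e * (x : A)).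
- exact: mul_linear.
- by move=> x; rewrite mulrA -expr2 -ee.
exists k, (mklin (@ker_val_linear _ _ _ _)), e; split=> // [x|y]; rewrite mklinE.
  by apply: val_inj; rewrite /= kE.
by rewrite kE.
Qed.
End IdempotentModules.

(** * The exact sequence *)

Section Sequence.
Variable A : comPzRingType.
Implicit Types (x y : K0 A) (c d : fgpClass A) (e f : A) (p : Spec A).

Definition K0_class c : K0 A := fdiff c 0.

Lemma K0_classD c d : K0_class (c + d) = K0_class c + K0_class d.
Proof.
have -> : K0_class c + K0_class d = fdiff (c + d) (0 + 0) by exact: gaddE.
by rewrite addr0.
Qed.

Lemma K0_classM c d : K0_class (c * d) = K0_class c * K0_class d.
Proof.
have -> : K0_class c * K0_class d =
    fdiff (c * d + 0 * 0) (c * 0 + 0 * d) by exact: gmulE.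
by rewrite !mulr0 mul0r !addr0.
Qed.

Lemma K0_class1 : K0_class 1 = 1. Proof. by []. Qed.

Lemma fdiffE c d : (fdiff c d : K0 A) = K0_class c - K0_class d.
Proof.
have -> : - K0_class d = fdiff 0 d by exact: goppE.
have -> : K0_class c + fdiff 0 d = fdiff (c + 0) (0 + d) by exact: gaddE.
by rewrite addr0 add0r.
Qed.

Lemma virtual_rank_class p c : virtual_rank p (K0_class c) = class_rank p c.
Proof. by rewrite virtual_rankE (class_rank_nat p 0) subr0. Qed.

(** Adding a complement of the auxiliary module makes it free, so [L] is stably trivial. *)
Lemma K0_class_eq1 (L : fgpModule A) : constant_rank L 1 ->
  K0_class (isoclass L) = 1 -> isoclass L = 1.
Proof.
move=> L1 /fdiffP[k]; rewrite !addr0; move: k; apply: classW => K.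
have [N [n e]] := fgp_complement K.
move=> /(congr1 (fun c => c + isoclass N)); rewrite -!addrA e => {}e.
apply/(isoclass_eq L (fgp_one A)); apply: (@stably_trivial _ _ n) => //.
apply/(isoclass_eq (fgp_sum L (fgp_free A n)) (fgp_free A (1 + n))).
by rewrite -isoclassD !isoclass_free e natrD.
Qed.

Lemma Pic_op_closed (c d : Pic A) : elts c -> elts d -> elts (op c d).
Proof.
move=> [L [L1 ->]] [M [M1 ->]]; exists (fgp_tens L M); rewrite -isoclassM; split=> // p.
by rewrite -class_rankE -isoclassM class_rankM !class_rankE L1 M1.
Qed.

Lemma Pic_inverse (c : Pic A) :
  elts c -> exists d : Pic A, elts d /\ op c d = neutral (Pic A).
Proof.
move=> [L [L1 ->]]; have [M [M1 LM]] := rank1_inverse L1.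
by exists (isoclass M); split=> //; exists M.
Qed.

Lemma Pic_abelian_group : is_abelian_group (Pic A).
Proof.
split.
  by exists (fgp_one A); split=> // p; rewrite -class_rankE (class_rank_nat p 1).
split; first exact: Pic_op_closed.
split; first by move=> x y z _ _ _; apply: mulrA.
split; first by move=> x y _ _; apply: mulrC.
split; first by move=> x _; apply: mul1r.
exact: Pic_inverse.
Qed.

Lemma K0_units_abelian_group : is_abelian_group (K0_units A).
Proof.
split; first by exists 1; rewrite mulr1.
split; first by move=> x y [x' e] [y' f]; exists (x' * y'); rewrite mulrACA e f mulr1.
split; first by move=> x y z _ _ _; apply: mulrA.
split; first by move=> x y _ _; apply: mulrC.
split; first by move=> x _; apply: mul1r.
by move=> x [y e]; exists y; split=> //; exists x; rewrite mulrC.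
Qed.

(** The first form is an orthogonal sum, to which [idem_classD] applies. *)
Lemma idem_xor e f : e = e ^+ 2 -> f = f ^+ 2 ->
  e + f - 2%:R * (e * f) = e * (1 - f) + f * (1 - e) /\
  e + f - 2%:R * (e * f) = (e + f - 2%:R * (e * f)) ^+ 2.
Proof.
move=> ee ff; split; first by ring.
transitivity (e ^+ 2 + f ^+ 2 + 2%:R * e * f + 4%:R * e ^+ 2 * f ^+ 2
  - 4%:R * e ^+ 2 * f - 4%:R * e * f ^+ 2); last by ring.
by rewrite -ee -ff; ring.
Qed.

Lemma idempotents_abelian_group : is_abelian_group (idempotents A).
Proof.
split; first by rewrite /= expr0n.
split; first by move=> e f ee ff; apply: (idem_xor ee ff).2.
split; first by move=> e f g _ _ _ /=; ring.
split; first by move=> e f _ _ /=; ring.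
split; first by move=> e _ /=; ring.
move=> e ee; exists e; split=> //=.
by rewrite -expr2 -ee; ring.
Qed.

(** It mirrors the rule of signs: a product of two ranks from {1, -1} is 1 exactly when they
    agree. *)
Lemma prime_xor p e f : e = e ^+ 2 -> f = f ^+ 2 ->
  prime_set p (e + f - 2%:R * (e * f)) <-> (prime_set p e <-> prime_set p f).
Proof.
move=> ee ff; have [ef|ef] := EM (prime_set p e); have [pf|pf] := EM (prime_set p f).
- split=> // _; apply: primeD; first exact: primeD.
  by apply: primeN; rewrite mulrA; apply: primeMl.
- split=> [h|[/(_ ef)//]]; case: pf.
  have -> : f = e + f - 2%:R * (e * f) + (2%:R * f - 1) * e by ring.
  by apply: primeD => //; apply: primeMl.
- split=> [h|[_ /(_ pf)//]]; case: ef.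
  have -> : e = e + f - 2%:R * (e * f) + (2%:R * e - 1) * f by ring.
  by apply: primeD => //; apply: primeMl.
- split=> // _; rewrite (idem_xor ee ff).1.
  have pe' := (idem_primeC p ee).2 ef; have pf' := (idem_primeC p ff).2 pf.
  by apply: primeD; apply: primeMl.
Qed.

(** On units the default value of [xget] is never reached. *)
Lemma K0_to_idempotentsP (x : K0_units A) : elts x ->
  is_rank_idempotent x (K0_to_idempotents x).
Proof.
by move=> [y /unit_rank_idempotent[e [eP _]]]; apply: xgetPex; exists e.
Qed.

Lemma K0_to_idempotents_eq (x : K0_units A) e : elts x -> e = e ^+ 2 ->
  (forall p, virtual_rank p x = 1 <-> prime_set p e) -> K0_to_idempotents x = e.
Proof.
move=> ux ee eP; have [g2 gP] := (is_rank_idempotentE _ _).1 (K0_to_idempotentsP ux).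
by apply: idem_prime_inj => // p; rewrite -gP eP.
Qed.

Lemma Pic_to_K0_hom : is_hom (@Pic_to_K0 A).
Proof.
split=> [c /Pic_inverse[d [_ cd]]|c d _ _]; last exact: K0_classM.
by exists (K0_class d); rewrite /Pic_to_K0 -/(K0_class c) -K0_classM; congr K0_class.
Qed.

Lemma Pic_to_K0_inj (c d : Pic A) :
  elts c -> elts d -> Pic_to_K0 c = Pic_to_K0 d -> c = d.
Proof.
move=> uc ud cd; have [d' [ud' dd']] := Pic_inverse ud.
have [L [L1 E]] := Pic_op_closed uc ud'.
have e1 : op c d' = 1.
  rewrite E; apply: K0_class_eq1 => //; rewrite -E [LHS]K0_classM.
  by rewrite [K0_class c]cd -K0_classM [d * d']dd'.
by have := mul1r d; rewrite -{1}e1 /= -mulrA [d' * d]mulrC [d * d']dd' mulr1.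
Qed.

Lemma K0_to_idempotents_hom : is_hom (@K0_to_idempotents A).
Proof.
split=> [x ux|x y ux uy]; first by have [] := K0_to_idempotentsP ux.
have [ex Px] := (is_rank_idempotentE _ _).1 (K0_to_idempotentsP ux).
have [ey Py] := (is_rank_idempotentE _ _).1 (K0_to_idempotentsP uy).
apply: K0_to_idempotents_eq.
- by have [_ [h _]] := K0_units_abelian_group; apply: h.
- exact: (idem_xor ex ey).2.
move=> p; rewrite prime_xor // -Px -Py /= virtual_rankM.
have [x' /(virtual_rank_unit p)[->|->]] := ux;
  have [y' /(virtual_rank_unit p)[->|->]] := uy;
  by split=> // -[h1 h2]; first [exact: h1|exact: h2].
Qed.

Lemma K0_to_idempotents_ker (hA : line_bundle_property A) (x : K0_units A) : elts x ->
  K0_to_idempotents x = neutral (idempotents A) <->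
  exists c : Pic A, elts c /\ Pic_to_K0 c = x.
Proof.
move=> ux; split=> [gx|[c [[L [L1 ->]] <-]]]; last first.
  apply: K0_to_idempotents_eq; first by apply: Pic_to_K0_hom.1; exists L.
    by rewrite expr0n.
  by move=> p; split=> _; [apply: prime0|rewrite virtual_rank_class class_rankE L1].
have [_ xP] := (is_rank_idempotentE _ _).1 (K0_to_idempotentsP ux).
rewrite gx in xP.
have {gx}x1 p : virtual_rank p x = 1 by apply/xP; apply: prime0.
move: x ux xP x1; apply: fdiffW => c d _ _.
move: d; apply: classW => N; have [N' [n NN']] := fgp_complement N.
set x := fdiff _ _.
(* Adding [N'] to both terms of the difference replaces [N] by the free module of rank [n]. *)
have [M cN] : exists M : fgpModule A, c + isoclass N' = isoclass M.
  by exists (classrep (c + isoclass N')); rewrite classrepK.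
have xE : x = K0_class (isoclass M) - K0_class n%:R.
  by rewrite /x fdiffE -NN' -cN !K0_classD; ring.
move=> x1.
have M1 : constant_rank M n.+1.
  move=> p; have := x1 p; rewrite xE -fdiffE virtual_rankE class_rankE class_rank_nat.
  by move=> /eqP; rewrite subr_eq => /eqP[->].
have [k kP] := hA _ _ (fgpP M) M1.
have fL : fgp (exterior n.+1 M).
  by apply: fgp_summand; apply: fgp_iso kP _; apply: fgp_prod (fgp_row A k) (fgpP M).
pose L := FgpModule fL.
have e : k%:R + isoclass M = (k + n)%:R + isoclass L.
  rewrite -!isoclass_free !isoclassD.
  exact/(isoclass_eq (fgp_sum (fgp_free A k) M) (fgp_sum (fgp_free A (k + n)) L)).
exists (isoclass L); split.
  (* The ranks in [e] satisfy k + (n + 1) = (k + n) + r, so r = 1. *)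
  exists L; split=> // p; have := congr1 (class_rank p) e.
  rewrite !class_rankD !class_rank_nat !class_rankE M1.
  by rewrite -addnA => /addnI; rewrite -addn1 => /addnI.
rewrite /Pic_to_K0 -/(K0_class _) xE; have := congr1 K0_class e.
rewrite !natrD !K0_classD => E; apply: (addrI (K0_class k%:R + K0_class n%:R)).
by rewrite -E; ring.
Qed.

(** The module eA has rank 0 on V(e) and rank 1 elsewhere, so this element has rank 1 on V(e) and -1
    elsewhere. *)
Definition K0_section (e : idempotents A) : K0_units A :=
  fdiff 1 (idem_class (e : A) + idem_class (e : A)).

Lemma K0_sectionE (e : A) :
  K0_section e = 1 - K0_class (idem_class e) - K0_class (idem_class e) :> K0 A.
Proof. by rewrite /K0_section fdiffE K0_classD K0_class1; ring. Qed.

(** With [a] and [b] the classes of eA and fA, the exclusive or has class a + b - 2ab, and (1 -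
    2a)(1 - 2b) = 1 - 2(a + b - 2ab). *)
Lemma K0_sectionM e f : e = e ^+ 2 -> f = f ^+ 2 ->
  K0_section (e + f - 2%:R * (e * f)) = (K0_section e : K0 A) * K0_section f.
Proof.
move=> ee ff; rewrite (idem_xor ee ff).1 !K0_sectionE.
have iab (g h : A) : g = g ^+ 2 -> h = h ^+ 2 -> g * h = (g * h) ^+ 2.
  by move=> gg hh; rewrite exprMn -gg -hh.
have part (g h : A) : g = g ^+ 2 -> h = h ^+ 2 ->
    K0_class (idem_class g) = K0_class (idem_class g) * K0_class (idem_class h) +
      K0_class (idem_class (g * (1 - h))).
  move=> gg hh; have h0 : h * (1 - h) = 0 by rewrite mulrBr mulr1 -expr2 -hh subrr.
  rewrite -K0_classM idem_classM // -K0_classD -idem_classD.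
  - by rewrite -mulrDr addrC subrK mulr1.
  - exact: iab.
  - exact: iab (idemC hh).
  - by rewrite mulrACA h0 mulr0.
rewrite idem_classD; last first.
- rewrite mulrACA [(1 - f) * _]mulrC mulrACA.
  by rewrite [e * (1 - e)]mulrBr mulr1 -expr2 -ee subrr mul0r.
- exact: iab (idemC ee).
- exact: iab (idemC ff).
rewrite K0_classD; move: (part e f ee ff) (part f e ff ee).
set a := K0_class (idem_class e); set b := K0_class (idem_class f).
set c := K0_class _; set d := K0_class _ => Ea Eb.
have -> : c = a - a * b by rewrite [X in X - _]Ea; ring.
have -> : d = b - b * a by rewrite [X in X - _]Eb; ring.
ring.
Qed.

Lemma virtual_rank_section p e : e = e ^+ 2 ->
  virtual_rank p (K0_section e) = 1 <-> prime_set p e.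
Proof.
move=> ee; have [r0 r1] := class_rank_idem p ee.
rewrite virtual_rankE class_rankD (class_rank_nat p 1).
have [pe|pe] := EM (prime_set p e); first by rewrite r0.
by rewrite r1.
Qed.

Lemma K0_section_unit e : e = e ^+ 2 -> (K0_section e : K0 A) * K0_section e = 1.
Proof.
move=> ee; rewrite -K0_sectionM //.
have -> : e + e - 2%:R * (e * e) = 0 by rewrite -expr2 -ee; ring.
have z : 0 = 0 ^+ 2 :> A by rewrite expr0n.
(* The class of the zero ideal equals its own double, hence vanishes in [K0]. *)
have := idem_classD z z (mulr0 0); rewrite addr0 => /(congr1 K0_class).
rewrite K0_classD K0_sectionE => E.
have -> : K0_class (idem_class 0) = 0.
  by apply: (addrI (K0_class (idem_class 0))); rewrite -E addr0.
by rewrite !subr0.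
Qed.

Lemma K0_section_hom : is_hom K0_section.
Proof.
split=> [e ee|e f ee ff]; last exact: K0_sectionM.
by exists (K0_section e); apply: K0_section_unit.
Qed.

Lemma K0_sectionK (e : idempotents A) : elts e -> K0_to_idempotents (K0_section e) = e.
Proof.
move=> ee; apply: K0_to_idempotents_eq => // [|p]; first exact: K0_section_hom.1.
exact: virtual_rank_section.
Qed.
End Sequence.

(** The first conjunct identifies the map [K0_to_idempotents], defined by choice, with the map g of
    the sequence. *)
Theorem corollary4p7 (A : comPzRingType) (hA : line_bundle_property A) :
  (forall x : K0_units A, elts x -> exists! e : A, is_rank_idempotent x e) /\
  split_exact (@Pic_to_K0 A) (@K0_to_idempotents A).
Proof.
split; first by move=> x [y]; apply: unit_rank_idempotent.
split.
  split; [exact: Pic_abelian_group|exact: K0_units_abelian_group|].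
  exact: idempotents_abelian_group.
split; first exact: Pic_to_K0_hom.
split; first exact: K0_to_idempotents_hom.
split; first exact: Pic_to_K0_inj.
split; first exact: K0_to_idempotents_ker.
split; last first.
  exists (@K0_section A); split; first exact: K0_section_hom.
  exact: K0_sectionK.
move=> e ee; exists (K0_section e); split; last exact: K0_sectionK.
exact: (K0_section_hom A).1.
Qed.
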